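(* Let $T$ be a closed 3-dimensional triangulation. There is a bijection between: (a) Morse gradients on $T$ with two critical simplices, up to re-pointing; (b) local constructions of $T$, up to weak equivalence.
   Context: Complexes are finite, connected, oriented, non-degenerate CW-complexes up to homeomorphisms preserving the cell structure; non-degenerate means that the characteristic map of each cell restricts to a homeomorphism from each connected component of the preimage of the interior of a lower-dimensional cell onto that interior, and the preimage of a vertex is a set of vertices. A closed 3-dimensional triangulation $T$ is such a complex whose cells are all simplices and in which every triangle belongs to two (not necessarily distinct) tetrahedra. $S_k(T)$ denotes its set of $k$-simplices. **Morse gradients.** A discrete vector field on $T$ is a collection $\mathcal L$ of pairwise disjoint ordered pairs $(\eta,\eta')$ with $\eta\in S_k(T)$, $\eta'\in S_{k+1}(T)$ and $\eta$ contained in $\eta'$ ($\eta$ is said to be oriented towards $\eta'$). Simplices occurring in no pair are critical. A walk is a sequence $(\eta^1,\dots,\eta^p)$ of simplices such that, for each $i<p$, if $\eta^i\in S_k(T)$ then either $\eta^{i+1}\in S_{k+1}(T)$ and $(\eta^i,\eta^{i+1})\in\mathcal L$, or $\eta^{i+1}$ is a $(k-1)$-simplex contained in $\eta^i$ and $(\eta^{i+1},\eta^i)\notin\mathcal L$. A walk is a cycle if $p>1$ and $\eta^1=\eta^p$. When $(\eta,\eta')\in\mathcal L$ and $\eta$ occurs more than once as a face of $\eta'$ (several faces of $\eta'$ being identified to $\eta$), the walk $(\eta,\eta',\eta)$ also counts as a cycle. A Morse gradient is a discrete vector field with no cycles. For a Morse gradient with two critical simplices these are a vertex and a tetrahedron;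 the edges having a vertex oriented towards them form a spanning tree of the 1-skeleton and the triangles oriented towards a tetrahedron are dual to the edges of a spanning tree of the dual graph (vertices = tetrahedra, edges = triangles). Two Morse gradients are related by re-pointing if they only differ by the position of the critical vertex (resp. critical tetrahedron) within this spanning tree of the 1-skeleton (resp. of the dual graph), the orientations along the trees being changed accordingly. **Local constructions.** A spanning tree of tetrahedra $T_0$ of $T$ consists of all tetrahedra glued along the triangles dual to the edges of a spanning tree of the dual graph (its internal triangles), viewed as a triangulated 3-ball with boundary $\partial T_0$. $T^{T_0}$ is the 2-complex obtained from $T$ by removing the interiors of the tetrahedra and the internal triangles of $T_0$. If $T_0$ has $2n$ boundary triangles, a local construction of $T$ based on $T_0$ is a sequence $T_0,T_1,\dots,T_n=T$ where $T_{s+1}$ is obtained from $T_s$ by choosing an edge $\sigma_{s+1}$ of $\partial T_s$ shared by two boundary triangles and gluing these triangles together by folding along $\sigma_{s+1}$; the chosen edge is part of the data. Let $\Sigma_s$ be the triangle of $T^{T_0}$ resulting from the $s$-th gluing. The critical tree of the local construction is the spanning tree of edges of $T$ that remains after removing $\sigma_1,\Sigma_1,\dots,\sigma_n,\Sigma_n$ from $T^{T_0}$. Two local constructions are weakly equivalent if they are based on the same $T_0$ and lead to the same triangulation $T$ with the same critical tree $E$.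
   Formalization: The triangulation is taken to be a gluing of tetrahedra along triangles: edges and vertices are identified only as these gluings force and none lies outside a tetrahedron; with a dangling edge or two further edges folded together, gradients can exist without any local construction. *)

(* Defs.v *)
From HB Require Import structures.
From mathcomp Require Import all_boot fingroup perm.
Set Implicit Arguments. Unset Strict Implicit. Unset Printing Implicit Defensive.

(* Every tetrahedron has its vertices labelled by 'I_4, and its facet i is the
   triangle opposite to vertex i.  Facet i of t is glued to a facet of nbr t i;
   vertex j != i of that facet is glued to vertex [gmap t i j] of nbr t i, and
   [gmap t i i] is the label of the facet of nbr t i to which it is glued. *)
Record gluing := Gluing {
  tet : finType;
  nbr : tet -> 'I_4 -> tet;
  gmap : tet -> 'I_4 -> {perm 'I_4}
}.

Section Complexes.
Variable K : gluing.

Definition facet : finType := (tet K * 'I_4)%type.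
Definition opp (f : facet) : facet := (nbr f.1 f.2, gmap f.1 f.2 f.2).

(* A cell of the disjoint union of the tetrahedra: a tetrahedron together with
   a subset of its vertices. *)
Definition cell : finType := (tet K * {set 'I_4})%type.

(* For a set G of facets closed under [opp], T_G denotes the complex obtained
   from the disjoint union of the tetrahedra by performing only the gluings
   of the facets in G; its simplices are the classes of nonempty cells for the
   equivalence relation generated by these gluings. *)
Definition glued (G : {set facet}) : rel cell := fun c d =>
  [exists i, [&& (c.1, i) \in G, i \notin c.2
                & d == (nbr c.1 i, gmap c.1 i @: c.2)]].

Definition simplex : finType := {set cell}.
Definition class (G : {set facet}) (c : cell) : simplex :=
  [set d | connect (glued G) c d].
Definition simplices_of (G : {set facet}) (k : nat) : {set simplex} :=
  [set class G c | c : cell & #|c.2| == k.+1].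

Definition simplices (k : nat) : {set simplex} := simplices_of setT k.
Definition all_simplices : {set simplex} := \bigcup_(k < 4) simplices k.

Definition triangle (f : facet) : simplex := class setT (f.1, [set~ f.2]).

(* The same identifications for edges with a direction: (t, (a, b)) is the
   edge of t going from vertex a to vertex b. *)
Definition dedge : finType := (tet K * ('I_4 * 'I_4))%type.
Definition dglued (G : {set facet}) : rel dedge := fun x y =>
  [exists i, [&& (x.1, i) \in G, i != x.2.1, i != x.2.2
                & y == (nbr x.1 i, (gmap x.1 i x.2.1, gmap x.1 i x.2.2))]].

(* The dual graph restricted to a set D of triangles. *)
Definition dual_adj (D : {set simplex}) : rel (tet K) := fun t u =>
  [exists i, (triangle (t, i) \in D) && (nbr t i == u)].

End Complexes.

(* The identifications of edges and vertices are those generated by the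
   gluings of triangles.  [tsign t] is the sign of the labelling of t with
   respect to the orientation.  In a complex obtained in this way, the
   only possible degeneracy is an edge folded onto itself. *)
Record triangulation := Triangulation {
  gl :> gluing;
  tsign : tet gl -> bool;
  tet_gt0 : 0 < #|tet gl|;
  nbrK : forall t i, nbr (nbr t i) (gmap (g := gl) t i i) = t;
  gmapK : forall t i,
    gmap (nbr t i) (gmap (g := gl) t i i) = ((gmap t i)^-1)%g;
  opp_neq : forall f : facet gl, opp f != f;
  tconnected : forall t u : tet gl, connect (dual_adj (simplices gl 2)) t u;
  toriented : forall t i,
    odd_perm (gmap (g := gl) t i) = (tsign t == tsign (nbr t i));
  tnondegenerate : forall (t : tet gl) (a b : 'I_4), a != b ->
    ~~ connect (dglued setT) (t, (a, b)) (t, (b, a))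
}.

Section MorseGradients.
Variable T : triangulation.
Local Notation S := (simplices T).
Local Notation field := {set simplex T * simplex T}.

Definition contained (x y : simplex T) : bool :=
  [exists c in x, exists d in y, (c.1 == d.1) && (c.2 \subset d.2)].

(* x occurs at least twice as a face of y *)
Definition repeated_face (x y : simplex T) : bool :=
  [exists c in x, exists c' in x, exists d in y,
    [&& c != c', c.1 == d.1, c'.1 == d.1, c.2 \subset d.2 & c'.2 \subset d.2]].

Definition discrete_vector_field (L : field) : bool :=
  [forall p in L, exists k : 'I_3,
     [&& p.1 \in S k, p.2 \in S k.+1 & contained p.1 p.2]]
  && [forall p in L, forall q in L,
        (p != q) ==> [disjoint [set p.1; p.2] & [set q.1; q.2]]].

Definition walk_step (L : field) : rel (simplex T) := fun x y =>
  ((x, y) \in L)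
  || [exists k : 'I_3,
        [&& x \in S k.+1, y \in S k, contained y x & (y, x) \notin L]].

Definition acyclic (L : field) : bool :=
  [forall x, forall y, walk_step L x y ==> ~~ connect (walk_step L) y x]
  && [forall p in L, ~~ repeated_face p.1 p.2].

Definition morse_gradient (L : field) : bool :=
  discrete_vector_field L && acyclic L.

Definition critical (L : field) : {set simplex T} :=
  [set x in all_simplices T | [forall p in L, (x != p.1) && (x != p.2)]].

Definition morse2 : choiceType :=
  {L : field | morse_gradient L && (#|critical L| == 2)}.

Definition vertex_tree (L : field) : {set simplex T} :=
  [set p.2 | p in L & p.1 \in S 0].
Definition tet_tree (L : field) : {set simplex T} :=
  [set p.1 | p in L & p.2 \in S 3].
Definition edge_part (L : field) : field := [set p in L | p.1 \in S 1].

(* Same spanning trees, and same pairs outside of the trees.  On a given tree,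
   the orientation (each node other than the critical one is matched with its
   edge leading towards the critical node) depends only on the position of the
   critical node. *)
Definition repointing : rel morse2 := fun L L' =>
  [&& vertex_tree (val L) == vertex_tree (val L'),
      tet_tree (val L) == tet_tree (val L')
    & edge_part (val L) == edge_part (val L')].

Lemma repointing_refl : reflexive repointing.
Proof. by move=> L; rewrite /repointing !eqxx. Qed.
Lemma repointing_sym : symmetric repointing.
Proof.
move=> L L'; rewrite /repointing (eq_sym (vertex_tree _)).
by rewrite (eq_sym (tet_tree _)) (eq_sym (edge_part _)).
Qed.
Lemma repointing_trans : transitive repointing.
Proof.
move=> L2 L1 L3 /and3P[/eqP a1 /eqP a2 /eqP a3] /and3P[/eqP b1 /eqP b2 /eqP b3].
by rewrite /repointing a1 a2 a3 b1 b2 b3 !eqxx.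
Qed.
Canonical repointing_equiv :=
  EquivRel repointing repointing_refl repointing_sym repointing_trans.

End MorseGradients.

Section LocalConstructions.
Variable T : triangulation.
Local Notation S := (simplices T).

Definition sides (D : {set simplex T}) : {set facet T} :=
  [set f | triangle f \in D].

(* A set of triangles dual to the edges of a spanning tree of the dual graph,
   which may have loops and multiple edges: no edge of the tree lies on a
   cycle of the tree. *)
Definition dual_spanning_tree (D : {set simplex T}) : bool :=
  [&& D \subset S 2,
      [forall t, forall u, connect (dual_adj D) t u]
    & [forall f : facet T, (triangle f \in D) ==>
         ~~ connect (dual_adj (D :\ triangle f)) f.1 (nbr f.1 f.2)]].

(* The boundary triangles of T_G are the facets outside of G.  The two facets
   f and opp f, forming the triangle Sigma of T, are boundary triangles of T_G
   sharing the edge sigma of T_G, and the gluing of f to opp f fixes sigma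
   (no reversal), that is, it folds along sigma. *)
Definition fold (G : {set facet T}) (sigma Sigma : simplex T) : bool :=
  [exists f : facet T, exists a : 'I_4, exists b : 'I_4,
    [&& f \notin G, opp f \notin G, triangle f == Sigma,
        a != b, a != f.2, b != f.2, sigma == class G (f.1, [set a; b])
      & connect (dglued G) (f.1, (a, b))
          ((opp f).1, (gmap f.1 f.2 a, gmap f.1 f.2 b))]].

(* The complexes T_s are the partial gluings T_G, all of whose tetrahedra are
   those of T; T_G is T itself when G is the set of all facets. *)
Fixpoint folds (G : {set facet T}) (s : seq (simplex T * simplex T)) : bool :=
  if s is p :: s' then fold G p.1 p.2 && folds (G :|: sides [set p.2]) s'
  else G == setT.

(* The spanning tree of tetrahedra T_0, given by its internal triangles, and
   the sequence of pairs (sigma_s, Sigma_s); each fold consumes two boundary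
   triangles, so that the length is half their number in T_0. *)
Definition local_construction : choiceType :=
  {c : {set simplex T} * seq (simplex T * simplex T) |
     dual_spanning_tree c.1 && folds (sides c.1) c.2}.

(* sigma_s is an edge of T_{s-1}, i.e. a set of cells included in the edge of T
   onto which it is mapped. *)
Definition critical_tree (c : local_construction) : {set simplex T} :=
  [set e in S 1 |
     all (fun p : simplex T * simplex T => ~~ (p.1 \subset e)) (val c).2].

Definition weakly_equivalent : rel local_construction := fun c c' =>
  ((val c).1 == (val c').1) && (critical_tree c == critical_tree c').

Lemma weakly_equivalent_refl : reflexive weakly_equivalent.
Proof. by move=> c; rewrite /weakly_equivalent !eqxx. Qed.
Lemma weakly_equivalent_sym : symmetric weakly_equivalent.
Proof.
move=> c c'; rewrite /weakly_equivalent (eq_sym (val c).1).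
by rewrite (eq_sym (critical_tree _)).
Qed.
Lemma weakly_equivalent_trans : transitive weakly_equivalent.
Proof.
move=> c2 c1 c3 /andP[/eqP a1 /eqP a2] /andP[/eqP b1 /eqP b2].
by rewrite /weakly_equivalent a1 a2 b1 b2 !eqxx.
Qed.
Canonical weakly_equivalent_equiv :=
  EquivRel weakly_equivalent weakly_equivalent_refl weakly_equivalent_sym
    weakly_equivalent_trans.

End LocalConstructions.

(* Main.v *)
Require Import Defs.
From mathcomp Require Import all_boot fingroup perm zify.
(* Makes [class] the class of a cell again, not a conjugacy class. *)
Import Defs.

(** The two sides are compared through pairs (D, E) of a set D of triangles and a
    set E of edges: a gradient L gives [tet_tree L] and [vertex_tree L], a
    local construction gives its internal triangles and its critical tree.
    Weak equivalence is equality of these pairs by definition. For gradients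
    with two critical simplices, re-pointing is so too: what remains of L is
    an acyclic matching of all edges outside E with all triangles outside D,
    and there is only one ([matching_unique]), because a second one would
    yield an infinite sequence of edges of increasing height. It remains to
    see that the same pairs come from gradients and from local constructions.

    Both are related to collapses. The tetrahedra around an edge of T form one
    cycle, the orbit of a flag under a rotation. Two boundary triangles of T_G
    which are to be glued share an edge precisely when all other gluings
    around this edge belong to G ([dglued_orbit], [free_orbit]). In other
    words, the edge is free in the 2-complex of the triangles which remain to
    be glued: only one of them contains it, and only once. Hence local
    constructions based on D amount to sequences of collapses of the complex
    of the triangles outside D, and E is the set of the uncollapsed edges
    ([folds_collapse], [collapse_folds]).

    From a gradient to collapses, it is enough to collapse the highest pairs
    first, the height of a simplex being the number of simplices that walks
    reach from it ([gradient_collapse]). Moreover the triangles matched with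
    tetrahedra form a spanning tree, as each noncritical tetrahedron has a
    higher parent ([tet_tree_spanning]).

    Conversely, the collapsed pairs are the middle part of a gradient, the
    other parts being the trees E, oriented towards a root, and D, oriented
    from one ([collapse_gradient]). Here one has to prove that E is a tree. It
    is connected, since a collapsed edge can be replaced by the other two
    edges of its triangle ([uncollapsed_connected]). It has no cycle, because
    it has at most V - 1 edges for V vertices ([card_uncollapsed]), and this
    count rests on an inequality: there are at most as many edges as vertices
    and tetrahedra together ([euler_ineq]). As T need not be a manifold, this
    is not an equality: the difference is the total genus of the vertex links,
    which are closed oriented surfaces. Its sign is a fact on permutations,
    the links being encoded by two permutations of the flags ([genus_ge0]). *)

Set Implicit Arguments. Unset Strict Implicit. Unset Printing Implicit Defensive.

(** * Components of finite graphs *)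

Section Components.
Variable X : finType.
Implicit Types e : rel X.

(** Induction along a path, adding the steps at its end. *)
Lemma connect_ind e (P : X -> Prop) x :
  P x -> (forall a b, connect e x a -> P a -> e a b -> P b) ->
  forall y, connect e x y -> P y.
Proof.
move=> P0 PS y /connectP[p]; elim/last_ind: p y => [|p z IH] y /=; first by move=> _ ->.
rewrite rcons_path last_rcons => /andP[pp ez] ->.
apply: PS ez; last exact: IH.
by apply/connectP; exists p.
Qed.

(** Adding the edge x y to e' merges at most two components, and none if its ends
    were already connected. The edges of e are only known up to connection in
    e'. *)
Lemma leq_components e e' x y :
    connect_sym e -> connect_sym e' ->
    (forall a b, e a b -> [|| connect e' a b,
       connect e' a x && connect e' b y | connect e' a y && connect e' b x]) ->
  #|roots e'| <= #|roots e| + ~~ connect e' x y.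
Proof.
(* m moves the component of y into that of x; after this move the paths of e stay
   within the components of e'. *)
move=> se se' ee'; pose m a := if connect e' a y then x else a.
have q a b : connect e a b -> connect e' (m a) (m b).
  move: b; apply: connect_ind => // c d _ ac cd.
  apply: connect_trans ac _; move: cd => /ee'.
  rewrite /m; case: ifP => cy; case: ifP => dy; rewrite ?andbF ?andbT ?orbF //=.
  - by case/orP=> [cd|]; [rewrite -(same_connect se' cd) cy in dy | rewrite se'].
  - by case/orP=> // cd; rewrite (same_connect se' cd) dy in cy.
(* One root per component of e', without that of y when the new edge really
   merges; on A the map m only moves a vertex within its component. *)
pose A := [pred a | roots e' a & connect e' x y || (a != root e' y)].
have mA a : A a -> connect e' (m a) a.
  case/andP=> ra xy; rewrite /m; case: ifP => // ay.
  case/orP: xy => [xy|/eqP[]]; first by rewrite (connect_trans xy) // se'.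
  by rewrite -(eqP ra); apply/(rootP se').
have cA : #|roots e'| <= #|A| + ~~ connect e' x y.
  rewrite /A; case: (connect e' x y) => /=.
    by rewrite addn0; apply/subset_leq_card/subsetP => a; rewrite !inE andbT.
  rewrite (cardD1 (root e' y)) addnC leq_add ?leq_b1 //.
  by apply/subset_leq_card/subsetP => a; rewrite !inE andbC.
apply: leq_trans cA _; rewrite leq_add2r.
rewrite -(card_in_imset (f := root e) (D := A)) => [|a b Aa Ab]; last first.
  move/(rootP se)/q => ab; have [/eqP<- _] := andP Aa; have [/eqP<- _] := andP Ab.
  apply/(rootP se'); apply: connect_trans (connect_trans ab (mA b Ab)).
  by rewrite se' mA.
apply/subset_leq_card/subsetP => _ /imsetP[a _ ->]; exact: roots_root.
Qed.

Lemma components_le (Y : finType) e (h : Y -> X) :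
  connect_sym e -> (forall x, exists y, connect e (h y) x) -> #|roots e| <= #|Y|.
Proof.
move=> se hx; apply: leq_trans (leq_image_card (root e \o h) predT).
apply/subset_leq_card/subsetP => x /eqP rx; have [y yx] := hx x.
by apply/imageP; exists y => //=; rewrite -[LHS]rx; apply/esym/(rootP se).
Qed.
End Components.

(** * The genus of a pair of permutations is nonnegative *)

Section Genus.
Variable X : finType.
Implicit Types s t : {perm X}.

(** The graph whose components are the orbits of the group generated by s and t. *)
Definition joined s t : rel X := fun a b => (b == s a) || (b == t a).

Lemma porbit_connect s e : (forall a, connect e a (s a)) ->
  forall a b, b \in porbit s a -> connect e a b.
Proof.
move=> es a _ /porbitP[i ->]; elim: i => [|i IH]; first by rewrite perm1.
by rewrite expgSr permM (connect_trans IH).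
Qed.

Lemma joinedl s t a : connect (joined s t) a (s a).
Proof. by apply: connect1; rewrite /joined eqxx. Qed.

Lemma joinedr s t a : connect (joined s t) a (t a).
Proof. by apply: connect1; rewrite /joined eqxx orbT. Qed.

Lemma joined_sym s t : connect_sym (joined s t).
Proof.
suff sub a b : connect (joined s t) a b -> connect (joined s t) b a.
  by move=> a b; apply/idP/idP; exact: sub.
move: b; apply: connect_ind => [|b c _ ab bc]; first exact: connect0.
apply: connect_trans _ ab; have fb s' : (forall d, connect (joined s t) d (s' d)) ->
    c = s' b -> connect (joined s t) c b.
  by move=> h ->; apply: (porbit_connect h); rewrite porbit_sym (mem_porbit s' 1).
by case/orP: bc => /eqP; apply: fb; [exact: joinedl | exact: joinedr].
Qed.

(** Two permutations of the same set draw an oriented map on a closed surface, of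
    Euler characteristic c(s) + c(t) + c(s t) - #|X|, where c counts the
    orbits; it is at most twice the number of components. Following Ree,
    transpositions are removed from s one by one. Removing one splits an orbit
    of s. If this disconnects the map, it also splits an orbit of s t, which
    pays for the new component; otherwise the number of orbits of s t drops by
    at most one, which the new orbit of s makes up for. *)
Lemma genus_ge0 s t :
  #|porbits s| + #|porbits t| + #|porbits (s * t)| <= #|X| + (#|roots (joined s t)|).*2.
Proof.
have [n le_n] := ubnP (#|X| - #|porbits s|); elim: n => // n IH in s le_n *.
have [s1|] := eqVneq s 1%g.
  rewrite s1 mul1g -addnA addnn leq_add ?leq_imset_card // leq_double.
  apply: leq_trans (leq_imset_card (porbit t) (roots (joined 1 t))).
  apply/subset_leq_card/subsetP => _ /imsetP[x _ ->].
  apply/imsetP; exists (root (joined 1 t) x); first exact: roots_root (joined_sym _ _) x.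
  move: (root _ _) (connect_root (joined 1 t) x); apply: connect_ind => // a b _ ->; rewrite /joined perm1 => /orP[]/eqP-> //.
  by rewrite -[in RHS](expg1 t) porbit_perm.
move=> s1; have [x sx] : exists x, x != s x.
  apply/existsP; apply: contraR s1 => /existsPn fixs.
  by apply/eqP/permP => x; rewrite perm1; have /negbNE/eqP<- := fixs x.
set y := s x in sx; pose s' : {perm X} := (tperm x y * s)%g.
have sE : s = (tperm x y * s')%g by rewrite mulgA tperm2 mul1g.
have cs' : #|porbits s'| = #|porbits s| + 1.
  have := porbits_mul_tperm s x y.
  by rewrite /= porbit_sym (mem_porbit s 1) sx /= addn0.
have cst : #|porbits (s * t)| + (x \notin porbit (s' * t) y).*2
    = #|porbits (s' * t)| + 1.
  by have := porbits_mul_tperm (s' * t) x y; rewrite /= mulgA -sE sx.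
have cX : #|porbits s'| <= #|X| by exact: leq_imset_card.
have /IH{}IH : #|X| - #|porbits s'| < n by rewrite cs' in cX *; lia.
rewrite cs' in IH.
have K : #|roots (joined s' t)| <= #|roots (joined s t)| + ~~ connect (joined s' t) x y.
  apply: leq_components; try exact: joined_sym.
  move=> a b /orP[]/eqP->; last by rewrite joinedr.
  rewrite sE permM; case: tpermP => [->|->|_ _]; last by rewrite joinedl.
  - by apply/or3P/Or32; rewrite connect0 joined_sym joinedl.
  - by apply/or3P/Or33; rewrite connect0 joined_sym joinedl.
have [xy|nxy] := boolP (connect (joined s' t) x y); first by rewrite xy in K; lia.
have : x \notin porbit (s' * t) y.
  apply: contra nxy; rewrite porbit_sym; apply: porbit_connect => a.
  by rewrite permM (connect_trans (joinedl s' t a)) ?joinedr.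
by rewrite nxy in K; lia.
Qed.

(** The orbits of a permutation of order dividing k have at most k elements. *)
Lemma card_porbits_ge s k : 0 < k -> (s ^+ k = 1)%g -> #|X| <= k * #|porbits s|.
Proof.
move=> k0 sk; rewrite -[#|X|]sum1_card (partition_big (porbit s) [in porbits s]) /=; last first.
  by move=> x _; exact: imset_f.
rewrite mulnC -sum_nat_const.
apply: leq_sum => _ /imsetP[y _ ->]; rewrite sum1_card.
rewrite -[k in _ <= k]card_ord; apply: leq_trans (leq_image_card (fun i : 'I_k => (s ^+ i)%g y) predT).
apply/subset_leq_card/subsetP => x; rewrite unfold_in -[_ _ _]/(porbit s x == porbit s y) eq_porbit_mem => /porbitP[j ->].
apply/imageP; exists (Ordinal (ltn_pmod j k0)) => //=.
by rewrite expg_mod.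
Qed.
End Genus.

(** * Distances and heights in finite graphs *)

Section Ranks.
Variable X : finType.

(** Distance functions yield parents: the next vertex on a shortest path is
    strictly closer to r. This is how trees get oriented towards a root. *)
Lemma distance_to (e : rel X) (r : X) : exists d : X -> nat,
  forall x, x != r -> connect e x r -> exists y, e x y && (d y < d x).
Proof.
(* Vertices out of the reach of r get the value 0. *)
pose P x n := [exists p : n.-tuple X, path e x p && (last x p == r)].
have exP x : exists n, P x n || ~~ connect e x r.
  have [/connectP[p ep er]|] := boolP (connect e x r); last by exists 0; rewrite orbT.
  by exists (size p); rewrite orbF; apply/existsP; exists (in_tuple p); rewrite ep er /=.
exists (fun x => ex_minn (exP x)) => x xr xconn.
case: (ex_minnP (exP x)) => n; rewrite xconn orbF => /existsP[[p /= /eqP sp]] /andP[].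
case: p sp => [|y p] /= sp; first by rewrite (negPf xr).
case/andP=> exy ep /eqP er _; exists y; rewrite exy -sp ltnS /=.
case: ex_minnP => m _; apply; apply/orP; left.
by apply/existsP; exists (in_tuple p); rewrite ep er eqxx.
Qed.

(** In an acyclic graph the number of vertices below x is a height, which turns
    acyclicity into well-founded induction. *)
Definition below (W : rel X) x := #|connect W x|.

Lemma below_lt (W : rel X) : (forall x y, W x y -> ~~ connect W y x) ->
  forall x y, W x y -> below W y < below W x.
Proof.
move=> acW x y xy; apply: proper_card; apply/properP; split.
  by apply/subsetP => z yz; rewrite inE (connect_trans (connect1 xy)).
by exists x; rewrite ?inE ?connect0 //; exact: acW.
Qed.

Lemma acyclic_rank (W : rel X) (mu : X -> nat) : (forall x y, W x y -> mu y < mu x) ->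
  forall x y, W x y -> ~~ connect W y x.
Proof.
move=> dec x y /dec xy; apply: contraL xy; rewrite -leqNgt.
move: x; apply: connect_ind => // a b _ le_ay /dec/ltnW.
by move/leq_trans; apply.
Qed.
End Ranks.

(** * Simplices and their faces *)

Section Simplices.
Variable T : triangulation.
Local Notation S := (simplices T).
Local Notation cls := (class (K := T) setT).
Implicit Types (c d : cell T) (f : facet T) (x y : simplex T) (G : {set facet T}).

Lemma oppK : involutive (@opp T).
Proof.
by case=> t i; rewrite /opp /= nbrK gmapK permK.
Qed.

Definition opp_closed G := forall f, f \in G -> opp f \in G.

Lemma opp_closedT : opp_closed setT. Proof. by move=> f; rewrite !inE. Qed.

Lemma gluedP G c d : reflect (exists i, [/\ (c.1, i) \in G, i \notin c.2
  & d = (nbr c.1 i, gmap c.1 i @: c.2)]) (glued G c d).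
Proof.
by apply: (iffP existsP) => -[i] => [/and3P[? ? /eqP ?]|[iG iA ->]]; exists i; rewrite // iG iA eqxx.
Qed.

Lemma imset_perm_mem (g : {perm 'I_4}) i (A : {set 'I_4}) : (g i \in g @: A) = (i \in A).
Proof. by apply: mem_imset; exact: perm_inj. Qed.

Lemma imset_permK (g : {perm 'I_4}) (A : {set 'I_4}) : (g^-1)%g @: (g @: A) = A.
Proof.
apply/setP => i; rewrite -[i in LHS](permK g) imset_perm_mem.
by rewrite imset_perm_mem.
Qed.

Lemma imset_permKV (g : {perm 'I_4}) (A : {set 'I_4}) : g @: ((g^-1)%g @: A) = A.
Proof. by have := imset_permK g^-1 A; rewrite invgK. Qed.

Lemma glued_sym G : opp_closed G -> symmetric (glued G).
Proof.
move=> Gopp; suff sub c d : glued G c d -> glued G d c by move=> c d; apply/idP/idP; exact: sub.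
case: c => t A; case/gluedP => i /= [iG iA ->]; apply/gluedP; exists (gmap t i i) => /=.
by rewrite imset_perm_mem gmapK nbrK imset_permK; split=> //; exact: Gopp iG.
Qed.

Lemma glued_csym G : opp_closed G -> connect_sym (glued G).
Proof. by move=> /glued_sym; exact: sym_connect_sym. Qed.

Lemma mem_class G c : c \in class G c. Proof. by rewrite inE connect0. Qed.

Lemma class_eq G c d : opp_closed G -> d \in class G c -> class G d = class G c.
Proof.
move=> Gopp; rewrite inE => cd; apply/setP => z; rewrite !inE.
by rewrite (same_connect (glued_csym Gopp) cd).
Qed.

Lemma cls_eq c d : d \in cls c -> cls d = cls c.
Proof. exact/class_eq/opp_closedT. Qed.

Lemma cls_cross t i (A : {set 'I_4}) : i \notin A ->
  cls (nbr t i, gmap (g := T) t i @: A) = cls (t, A).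
Proof.
move=> iA; apply: cls_eq; rewrite inE; apply: connect1.
by apply/gluedP; exists i; rewrite inE.
Qed.

(** Each gluing is a bijection on vertices, and a face of a glued cell lies in the
    glued facet too. Hence the faces of any cell of a simplex can be read off
    on a chosen one. *)
Lemma class_transport c d : d \in cls c -> exists g : {perm 'I_4},
  d.2 = g @: c.2 /\ forall B : {set 'I_4}, B \subset c.2 -> cls (d.1, g @: B) = cls (c.1, B).
Proof.
have im1 (A : {set 'I_4}) : (1%g : {perm 'I_4}) @: A = A.
  by rewrite (eq_imset _ (@perm1 _)) imset_id.
rewrite inE; move: d; apply: connect_ind => [|a b _ [g [eg hg]] /gluedP[i [_ ia ->]]] /=.
  by exists 1%g; split=> [|B _]; rewrite im1 //; case: c.
exists (g * gmap a.1 i)%g; split=> [|B Bc].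
  by rewrite eg -imset_comp; apply: eq_imset => j; rewrite permM.
rewrite -hg // -(@cls_cross a.1 i); last first.
  by apply: contra ia; rewrite eg; apply/subsetP/imsetS.
by rewrite -imset_comp; congr (cls (_, _)); apply: eq_imset => j; rewrite permM.
Qed.

Lemma card_class c d : d \in cls c -> #|d.2| = #|c.2|.
Proof. by case/class_transport => g [-> _]; rewrite card_imset //; exact: perm_inj. Qed.

Lemma class_simplex c k : #|c.2| = k.+1 -> cls c \in S k.
Proof. by move=> ck; apply/imsetP; exists c; rewrite // inE ck. Qed.

Lemma simplex_class x k c : x \in S k -> c \in x -> x = cls c /\ #|c.2| = k.+1.
Proof.
case/imsetP=> d; rewrite inE => /eqP dk -> dc; split; first by rewrite (cls_eq dc).
by rewrite (card_class dc).
Qed.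

Lemma simplexP x k : x \in S k -> exists2 c, x = cls c & #|c.2| = k.+1.
Proof. by case/imsetP=> c; rewrite inE => /eqP ck ->; exists c. Qed.

Lemma simplex_dim x k l : x \in S k -> x \in S l -> k = l.
Proof.
case/simplexP=> c -> ck cl; have [_] := simplex_class cl (mem_class _ _).
by rewrite ck => -[].
Qed.

Lemma simplex_dimE x k l : x \in S k -> (x \in S l) = (k == l).
Proof. by move=> xk; apply/idP/eqP => [/(simplex_dim xk)|<-]. Qed.

Lemma contained_class x k c : x \in S k -> contained x (cls c) ->
  exists2 B : {set 'I_4}, B \subset c.2 & x = cls (c.1, B).
Proof.
move=> xk /existsP[a /andP[ax /existsP[d /and3P[dc /eqP ad sad]]]].
have [g [eg hg]] := class_transport dc.
exists ((g^-1)%g @: a.2).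
  by rewrite -(imset_permK g c.2) -eg imsetS.
rewrite -hg; last by rewrite -(imset_permK g c.2) -eg imsetS.
rewrite imset_permKV -ad; case: (simplex_class xk ax) => -> _.
by case: (a).
Qed.

Lemma class_contained (t : tet T) (A B : {set 'I_4}) :
  B \subset A -> contained (cls (t, B)) (cls (t, A)).
Proof.
move=> BA; apply/existsP; exists (t, B); rewrite mem_class; apply/existsP; exists (t, A).
by rewrite mem_class eqxx.
Qed.

Lemma repeated_class x k c : x \in S k -> repeated_face x (cls c) ->
  exists A B : {set 'I_4}, [/\ A != B, A \subset c.2, B \subset c.2, x = cls (c.1, A) & x = cls (c.1, B)].
Proof.
move=> xk /existsP[a /andP[ax /existsP[b /andP[bx /existsP[d /andP[dc]]]]]].
case/and5P=> ab /eqP ad /eqP bd sad sbd.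
have [g [eg hg]] := class_transport dc.
have sub (A : {set 'I_4}) : A \subset d.2 -> (g^-1)%g @: A \subset c.2.
  by move=> Ad; rewrite -(imset_permK g c.2) -eg imsetS.
have im (A : {set 'I_4}) : A \subset d.2 -> cls (d.1, A) = cls (c.1, (g^-1)%g @: A).
  by move=> Ad; rewrite -hg ?sub // imset_permKV.
exists ((g^-1)%g @: a.2), ((g^-1)%g @: b.2); split; rewrite ?sub //.
- apply: contra ab => /eqP ab; rewrite (surjective_pairing a) (surjective_pairing b) ad bd.
  by rewrite -(imset_permKV g a.2) ab imset_permKV.
- by rewrite -im // -ad; case: (simplex_class xk ax) => -> _; case: (a).
- by rewrite -im // -bd; case: (simplex_class xk bx) => -> _; case: (b).
Qed.

Lemma class_repeated t (A B C : {set 'I_4}) : A != B -> A \subset C -> B \subset C ->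
  cls (t, A) = cls (t, B) -> repeated_face (cls (t, A)) (cls (t, C)).
Proof.
move=> AB AC BC E; apply/existsP; exists (t, A); rewrite mem_class.
apply/existsP; exists (t, B); rewrite E mem_class; apply/existsP; exists (t, C).
by rewrite mem_class -pair_eqE /= !eqxx AB AC BC.
Qed.

Definition fcell f : cell T := (f.1, [set~ f.2]).

Lemma fcell_inj : injective fcell.
Proof.
case=> t i [u j] [-> /setP/(_ i)]; rewrite !inE eqxx /= => /esym/negbT.
by rewrite negbK => /eqP->.
Qed.

Lemma fcell_cross f : (nbr f.1 f.2, gmap (g := T) f.1 f.2 @: [set~ f.2]) = fcell (opp f).
Proof.
congr (_, _); apply/setP => j; rewrite -(permKV (gmap f.1 f.2) j) imset_perm_mem !inE.
by rewrite (inj_eq perm_inj).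
Qed.

(** A triangle has just two sides, since a cell which misses one vertex can be
    carried through one facet only. *)
Lemma mem_triangle f d : (d \in triangle f) = (d == fcell f) || (d == fcell (opp f)).
Proof.
apply/idP/orP=> [|[]/eqP->].
- rewrite inE; move: d; apply: connect_ind => [|a b _ E /gluedP[i [_ ia ->]]]; first by left.
  have fi f' : a = fcell f' -> (nbr a.1 i, gmap (g := T) a.1 i @: a.2) = fcell (opp f').
    move=> ea; have -> : i = f'.2 by move: ia; rewrite ea !inE negbK => /eqP.
    by rewrite ea; exact: fcell_cross.
  by case: E => /eqP/fi->; [right | left; rewrite oppK].
- exact: mem_class.
by rewrite inE; apply: connect1; apply/gluedP; exists f.2; rewrite !inE eqxx fcell_cross.
Qed.

Lemma triangleE f : triangle f = [set fcell f; fcell (opp f)].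
Proof. by apply/setP => d; rewrite mem_triangle !inE. Qed.

Lemma triangle_opp f : triangle (opp f) = triangle f.
Proof. by rewrite !triangleE oppK setUC. Qed.

Lemma triangle_eq f f' : triangle f' = triangle f -> f' = f \/ f' = opp f.
Proof.
move=> E; have : fcell f' \in triangle f by rewrite -E mem_triangle eqxx.
by rewrite mem_triangle => /orP[]/eqP/fcell_inj; [left | right].
Qed.

Lemma triangle_S2 f : triangle f \in S 2.
Proof. by apply: class_simplex; rewrite /= cardsC1 card_ord. Qed.

Lemma triangleP x : x \in S 2 -> exists f, x = triangle f.
Proof.
case/simplexP=> -[t A] -> /= A3; have : #|~: A| = 1 by have := cardsC A; rewrite A3 card_ord; lia.
by move/eqP/cards1P => [i iA]; exists (t, i); rewrite /triangle /= -iA setCK.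
Qed.

Definition tetra (t : tet T) : simplex T := [set (t, setT)].

Lemma tetraE t : tetra t = cls (t, setT).
Proof.
apply/setP => d; rewrite !inE; apply/eqP/idP => [->|]; first exact: connect0.
by move: d; apply: connect_ind => // a b _ -> /gluedP[i [_ /=]]; rewrite inE.
Qed.

Lemma tetra_S3 t : tetra t \in S 3.
Proof. by rewrite tetraE class_simplex //= cardsT card_ord. Qed.

Lemma tetra_inj : injective tetra.
Proof. by move=> t u /set1_inj[]. Qed.

Lemma tetraP x : x \in S 3 -> exists t, x = tetra t.
Proof.
case/simplexP=> -[t A] -> /= A4; exists t; rewrite tetraE; congr (cls (_, _)).
by apply/eqP; rewrite eqEcard subsetT cardsT card_ord A4.
Qed.

Lemma triangle_tetra x t : x \in S 2 -> contained x (tetra t) -> exists i, x = triangle (t, i).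
Proof.
move=> x2; rewrite tetraE => /(contained_class x2)[B _ xE] /=.
have [_ /= B3] := simplex_class (c := (t, B)) x2 (ltac:(by rewrite xE mem_class)).
have : #|~: B| = 1 by have := cardsC B; rewrite B3 card_ord; lia.
by move/eqP/cards1P => [i iB]; exists i; rewrite xE /triangle /= -iB setCK.
Qed.

Lemma tetra_triangle t i : contained (triangle (t, i)) (tetra t).
Proof. by rewrite tetraE class_contained ?subsetT. Qed.

(** A triangle with both sides on one tetrahedron is a loop of the dual graph. *)
Lemma repeated_tetra t i : repeated_face (triangle (t, i)) (tetra t) -> nbr (g := T) t i = t.
Proof.
rewrite tetraE => /(repeated_class (triangle_S2 _))[A [B [/= AB _ _ EA EB]]].
have := mem_class setT (t, A); have := mem_class setT (t, B); rewrite -EA -EB !mem_triangle.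
rewrite /fcell /opp -!pair_eqE /= !eqxx /=.
case/orP=> [/eqP eB|/andP[/eqP/esym-> //]]; case/orP=> [/eqP eA|/andP[/eqP/esym-> //]].
by rewrite eA eB eqxx in AB.
Qed.

Lemma tetra_repeated t i : nbr (g := T) t i = t -> repeated_face (triangle (t, i)) (tetra t).
Proof.
move=> n; have op := @opp_neq T (t, i).
rewrite tetraE; apply: (class_repeated (B := [set~ gmap (g := T) t i i])) => //.
  apply: contra op => /eqP/setP/(_ i); rewrite !inE eqxx /= => /esym/negbT.
  by rewrite negbK /opp /= n => /eqP<-.
by have := triangle_opp (t, i); rewrite /opp /= n /triangle /= => ->.
Qed.

Lemma edgeP e : e \in S 1 -> exists t a b, a != b /\ e = cls (t, [set a; b]).
Proof.
case/simplexP=> -[t A] -> /= /eqP/cards2P[a [b [ab ->]]]; by exists t, a, b.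
Qed.

Lemma edge_S1 t a b : a != b -> cls (t, [set a; b]) \in S 1.
Proof. by move=> ab; apply: class_simplex; rewrite /= cards2 ab. Qed.

Lemma vertex_S0 t a : cls (t, [set a]) \in S 0.
Proof. by apply: class_simplex; rewrite /= cards1. Qed.

Lemma vertexP v : v \in S 0 -> exists t a, v = cls (t, [set a]).
Proof. by case/simplexP=> -[t A] -> /= /eqP/cards1P[a ->]; exists t, a. Qed.

Lemma vertex_edge v t a b : v \in S 0 -> contained v (cls (t, [set a; b])) ->
  v = cls (t, [set a]) \/ v = cls (t, [set b]).
Proof.
move=> v0 /(contained_class v0)[B /= sB vE].
have [_ /= /eqP/cards1P[i iB]] := simplex_class (c := (t, B)) v0 (ltac:(by rewrite vE mem_class)).
by move: sB; rewrite vE iB sub1set !inE => /orP[]/eqP->; [left | right].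
Qed.

Lemma edge_triangle e f : e \in S 1 -> contained e (triangle f) ->
  exists a b, [/\ a != b, a != f.2, b != f.2 & e = cls (f.1, [set a; b])].
Proof.
move=> e1 /(contained_class e1)[B /= sB eE].
have [_ /= /eqP/cards2P[a [b [ab eB]]]] := simplex_class (c := (f.1, B)) e1 (ltac:(by rewrite eE mem_class)).
move: sB; rewrite eE eB subUset !sub1set !inE => /andP[af bf].
by exists a, b.
Qed.

Lemma triangle_edge f a b : a != f.2 -> b != f.2 -> contained (cls (f.1, [set a; b])) (triangle f).
Proof. by move=> af bf; apply: class_contained; rewrite subUset !sub1set !inE af. Qed.

End Simplices.

(** * Permutations of the four labels *)

Notation o0 := (@Ordinal 4 0 isT).
Notation o1 := (@Ordinal 4 1 isT).
Notation o2 := (@Ordinal 4 2 isT).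
Notation o3 := (@Ordinal 4 3 isT).

Lemma ord4_cases (P : 'I_4 -> Prop) : P o0 -> P o1 -> P o2 -> P o3 -> forall i, P i.
Proof.
move=> P0 P1 P2 P3 [[|[|[|[|//]]]]] lti.
- by rewrite (_ : Ordinal lti = o0) //; exact: val_inj.
- by rewrite (_ : Ordinal lti = o1) //; exact: val_inj.
- by rewrite (_ : Ordinal lti = o2) //; exact: val_inj.
- by rewrite (_ : Ordinal lti = o3) //; exact: val_inj.
Qed.

(** Labels are often compared with the images p o0, .., p o3 of a permutation;
    this is the corresponding case analysis. *)
Lemma perm4_cases (p : {perm 'I_4}) (P : 'I_4 -> Prop) :
  P (p o0) -> P (p o1) -> P (p o2) -> P (p o3) -> forall i, P i.
Proof.
by move=> P0 P1 P2 P3 i; rewrite -(permKV p i); move: (p^-1%g i); exact: ord4_cases.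
Qed.

Lemma ord4_avoid (A : {set 'I_4}) : #|A| < 4 -> exists i, i \notin A.
Proof.
move=> A4; have : 0 < #|~: A| by have := cardsC A; rewrite card_ord; lia.
by case/card_gt0P=> i; rewrite inE; exists i.
Qed.

Lemma ord4_avoid3 (a b c : 'I_4) : exists i, [/\ i != a, i != b & i != c].
Proof.
have [|i] := @ord4_avoid (a |: [set b; c]).
  by rewrite cardsU1 cards2 !inE; case: (_ || _); case: (_ != _).
by rewrite !inE !negb_or => /and3P[]; exists i.
Qed.

Lemma perm4_exists (a b i : 'I_4) : a != b -> a != i -> b != i ->
  exists p : {perm 'I_4}, [/\ p o0 = a, p o1 = b & p o2 = i].
Proof.
move=> ab ai bi; have [j [ja jb ji]] := ord4_avoid3 a b i.
have un : uniq [:: a; b; i; j].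
  by rewrite /= !inE !negb_or ab ai bi ![_ == j]eq_sym ja jb ji.
have inj : injective (fun k : 'I_4 => nth a [:: a; b; i; j] k).
  by move=> k l /eqP; rewrite nth_uniq ?ltn_ord // => /eqP/val_inj.
by exists (perm inj); split; rewrite permE.
Qed.

Lemma perm4_eq (p q : {perm 'I_4}) : p o0 = q o0 -> p o1 = q o1 -> p o2 = q o2 -> p = q.
Proof.
move=> e0 e1 e2; apply/permP; apply: ord4_cases => //.
apply: (@perm4_cases q (fun i => p o3 = i -> i = q o3)) (erefl _) => //.
- by rewrite -e0 => /perm_inj.
- by rewrite -e1 => /perm_inj.
- by rewrite -e2 => /perm_inj.
Qed.

Notation tp23 := (tperm o2 o3).

Lemma perm4_or (p q : {perm 'I_4}) : p o0 = q o0 -> p o1 = q o1 -> p = q \/ p = (tp23 * q)%g.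
Proof.
move=> e0 e1; have [e2|e2] := eqVneq (p o2) (q o2); [left; exact: perm4_eq | right].
apply: perm4_eq; rewrite permM ?tpermL ?tpermD //.
apply: (@perm4_cases q (fun i => p o2 = i -> i = q o3)) (erefl _) => //.
- by rewrite -e0 => /perm_inj.
- by rewrite -e1 => /perm_inj.
- by move=> e; rewrite e eqxx in e2.
Qed.

(** * Flags and the rotation around an edge *)

Section Flags.
Variable T : triangulation.
Local Notation S := (simplices T).
Local Notation cls := (class (K := T) setT).
Implicit Types (c d : cell T) (f : facet T) (G : {set facet T}).

(** A flag (t, p) is a tetrahedron with its vertices listed in the order p o0, ..,
    p o3. It marks the vertex p o0, the directed edge from p o0 to p o1, and
    the facet opposite to p o2, which contains that edge. *)
Definition flag : finType := (tet T * {perm 'I_4})%type.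
Implicit Types x w : flag.

Definition relabel (q : {perm 'I_4}) x : flag := (x.1, q * x.2)%g.
Definition cross x : flag := (nbr x.1 (x.2 o2), x.2 * gmap (g := T) x.1 (x.2 o2))%g.
Definition flag_facet x : facet T := (x.1, x.2 o2).
Definition flag_dedge x : dedge T := (x.1, (x.2 o0, x.2 o1)).
Definition flag_edge x : cell T := (x.1, [set x.2 o0; x.2 o1]).
(** The orientation class of a flag. The rotation around an edge preserves it, so
    that going around an edge never leads to the mirror image of a flag. *)
Definition side x : bool := odd_perm x.2 (+) tsign x.1.

Lemma crossK : involutive cross.
Proof.
case=> t p; rewrite /cross /= permM nbrK gmapK -mulgA mulgV mulg1.
by [].
Qed.

Lemma relabelM (q r : {perm 'I_4}) x : relabel q (relabel r x) = relabel (q * r)%g x.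
Proof. by rewrite /relabel /= mulgA. Qed.

Lemma relabel_cross (q : {perm 'I_4}) x : q o2 = o2 -> relabel q (cross x) = cross (relabel q x).
Proof. by move=> q2; rewrite /relabel /cross /= permM q2 mulgA. Qed.

Notation mirror := (relabel tp23).

Lemma mirrorK : involutive mirror.
Proof. by move=> [t p]; rewrite relabelM tperm2 /relabel mul1g. Qed.

(** The rotation around the directed edge of a flag: cross the marked facet, then
    mark the other facet around the edge. *)
Definition turn x := mirror (cross x).
Definition back x := cross (mirror x).

Lemma turnK : cancel turn back. Proof. by move=> x; rewrite /back /turn mirrorK crossK. Qed.
Lemma backK : cancel back turn. Proof. by move=> x; rewrite /back /turn crossK mirrorK. Qed.

Definition turnp : {perm flag} := perm (can_inj turnK).

Lemma turnpE x : turnp x = turn x. Proof. exact: permE. Qed.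

Lemma orbit_ind x (P : flag -> Prop) : P x -> (forall w, w \in porbit turnp x -> P w -> P (turn w)) ->
  forall w, w \in porbit turnp x -> P w.
Proof.
move=> P0 PS w /porbitP[i ->]; elim: i => [|i IH]; first by rewrite perm1.
by rewrite expgSr permM turnpE; apply: PS => //; exact: mem_porbit.
Qed.

Lemma orbit_turn x w : (turn w \in porbit turnp x) = (w \in porbit turnp x).
Proof.
rewrite -turnpE !(porbit_sym _ _ x) -!eq_porbit_mem.
by have := porbit_perm turnp 1 w; rewrite expg1 => ->.
Qed.

Lemma orbit_back x w : (back w \in porbit turnp x) = (w \in porbit turnp x).
Proof. by rewrite -orbit_turn backK. Qed.

Lemma flag_facet_cross x : flag_facet (cross x) = opp (flag_facet x).
Proof. by rewrite /flag_facet /cross /= permM. Qed.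

Lemma flag_facet_mirror_turn x : flag_facet (mirror (turn x)) = opp (flag_facet x).
Proof. by rewrite mirrorK flag_facet_cross. Qed.

Lemma flag_facet_back x : flag_facet (back x) = opp (flag_facet (mirror x)).
Proof. by rewrite flag_facet_cross. Qed.

Lemma relabel23_0 x : (mirror x).2 o0 = x.2 o0. Proof. by rewrite permM tpermD. Qed.
Lemma relabel23_1 x : (mirror x).2 o1 = x.2 o1. Proof. by rewrite permM tpermD. Qed.
Lemma flag_facet_mirror x : flag_facet (mirror x) = (x.1, x.2 o3).
Proof. by rewrite /flag_facet /= permM tpermL. Qed.

Lemma flag_dedge_mirror x : flag_dedge (mirror x) = flag_dedge x.
Proof. by rewrite /flag_dedge relabel23_0 relabel23_1. Qed.

Lemma flag_edge_mirror x : flag_edge (mirror x) = flag_edge x.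
Proof. by rewrite /flag_edge relabel23_0 relabel23_1. Qed.

Lemma side_turn x : side (turn x) = side x.
Proof.
rewrite /side /turn /= !odd_permM odd_tperm /= toriented.
by case: (odd_perm _) (tsign _) (tsign _) => [] [] [].
Qed.

Lemma side_orbit x w : w \in porbit turnp x -> side w = side x.
Proof. by move: w; apply: orbit_ind => // w _ <-; exact: side_turn. Qed.

(** A flag is determined by its directed edge and its side. *)
Lemma flag_dedge_orbit_inj x w : w \in porbit turnp x -> flag_dedge w = flag_dedge x -> w = x.
Proof.
case: x w => [t p] [u q] /side_orbit; rewrite /side /= => sd [tu q0 q1].
rewrite tu in sd *; have [->//|qE] := perm4_or q0 q1.
move: sd; rewrite qE odd_permM odd_tperm /=.
by case: (odd_perm p); case: (tsign t).
Qed.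

Lemma dglued_turn G x : flag_facet x \in G -> dglued G (flag_dedge x) (flag_dedge (turn x)).
Proof.
move=> xG; apply/existsP; exists (x.2 o2); rewrite xG /= !(inj_eq perm_inj) /=.
by rewrite flag_dedge_mirror /flag_dedge /= !permM.
Qed.

(** There are only two facets around an edge of a tetrahedron: one leads to the
    next flag, the other one to the previous flag. *)
Lemma dglued_flag_dedge G x y : dglued G (flag_dedge x) y ->
  (flag_facet x \in G /\ y = flag_dedge (turn x)) \/ (flag_facet (mirror x) \in G /\ y = flag_dedge (back x)).
Proof.
case/existsP=> i /and4P[iG i0 i1 /eqP->].
have E w : flag_dedge (cross w) = (nbr w.1 (w.2 o2), (gmap (g := T) w.1 (w.2 o2) (w.2 o0), gmap w.1 (w.2 o2) (w.2 o1))).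
  by rewrite /flag_dedge /= !permM.
rewrite /turn flag_dedge_mirror /back !E relabel23_0 relabel23_1 /= flag_facet_mirror permM tpermL.
move: i iG i0 i1; apply: (perm4_cases (p := x.2)) => /=; rewrite ?eqxx // => iG _ _.
- by left.
- by right.
Qed.

Lemma dglued_sym G : opp_closed G -> symmetric (dglued G).
Proof.
move=> Gopp; suff sub (x y : dedge T) : dglued G x y -> dglued G y x.
  by move=> x y; apply/idP/idP; exact: sub.
case: x => t [a b] /existsP[i /and4P[/= iG ia ib /eqP->]].
apply/existsP; exists (gmap t i i) => /=.
by rewrite (Gopp (t, i) iG) !(inj_eq perm_inj) ia ib gmapK nbrK !permK eqxx.
Qed.

Lemma dglued_csym G : opp_closed G -> connect_sym (dglued G).
Proof. by move=> /dglued_sym; exact: sym_connect_sym. Qed.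

Lemma orbit_dglued x w : w \in porbit turnp x -> connect (dglued setT) (flag_dedge x) (flag_dedge w).
Proof.
move: w; apply: orbit_ind => // w _ xw; apply: connect_trans xw (connect1 _).
by apply: dglued_turn; rewrite inE.
Qed.

(** The rotation comes back to an edge of a tetrahedron only when it closes up: to
    meet it in the opposite direction would fold the edge onto itself, against
    non-degeneracy. *)
Lemma flag_edge_orbit_inj x w : w \in porbit turnp x -> flag_edge w = flag_edge x -> w = x.
Proof.
move=> xw [e1 /setP e2]; apply: flag_dedge_orbit_inj => //.
have := orbit_dglued xw; have := @tnondegenerate T x.1 (x.2 o0) (x.2 o1).
have d (p : {perm 'I_4}) : (p o0 == p o1) = false by rewrite (inj_eq perm_inj).
rewrite /flag_dedge e1 (inj_eq perm_inj) => /(_ isT) nd cn.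
have := e2 (w.2 o0); have := e2 (w.2 o1); rewrite !inE !eqxx orbT /=.
case/esym/orP=> /eqP E1; case/esym/orP=> /eqP E0; rewrite E0 E1 //.
- by have := d w.2; rewrite E0 E1 eqxx.
- by rewrite E0 E1 (negPf nd) in cn.
- by have := d w.2; rewrite E0 E1 eqxx.
Qed.

Lemma cls_turn x : cls (flag_edge (turn x)) = cls (flag_edge x).
Proof.
rewrite /turn flag_edge_mirror -(@cls_cross T x.1 (x.2 o2)) => [|]; last first.
  by rewrite !inE !(inj_eq perm_inj).
by rewrite imsetU !imset_set1 /flag_edge /= !permM.
Qed.

Lemma cls_orbit x w : w \in porbit turnp x -> cls (flag_edge w) = cls (flag_edge x).
Proof. by move: w; apply: orbit_ind => // w _ <-; exact: cls_turn. Qed.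

(** The corners of facets around the edge of x are the links from w to turn w
    along the orbit of x; the facet at such a corner is seen from w, or from
    turn w on its other side. *)
Lemma facet_around x (t : tet T) (A : {set 'I_4}) i :
    (t, A) \in cls (flag_edge x) -> i \notin A ->
  exists2 w, w \in porbit turnp x &
    (flag_facet w = (t, i) /\ flag_edge w = (t, A)) \/ (opp (flag_facet w) = (t, i) /\ flag_edge (turn w) = (t, A)).
Proof.
move=> tA iA; have [w xw tw] : exists2 w, w \in porbit turnp x & (t, A) = flag_edge w.
  move: (t, A) tA => {t i A iA} c; rewrite inE; move: c.
  apply: connect_ind => [|_ c _ [w xw ->] /gluedP[i [_]]]; first by exists x; rewrite ?porbit_id.
  rewrite !inE /= negb_or => /andP[i0 i1] ->.
  have E u : flag_edge (cross u) = (nbr u.1 (u.2 o2), gmap (g := T) u.1 (u.2 o2) @: [set u.2 o0; u.2 o1]).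
    by rewrite imsetU !imset_set1 /flag_edge /= !permM.
  move: i i0 i1; apply: (perm4_cases (p := w.2)); rewrite ?eqxx // => _ _.
  - by exists (turn w); rewrite ?orbit_turn // /turn flag_edge_mirror E.
  - exists (back w); rewrite ?orbit_back // /back E relabel23_0 relabel23_1 /=.
    by rewrite permM tpermL.
have : i \notin (flag_edge w).2 by rewrite -tw.
have [wt _] := tw; rewrite tw wt !inE /= negb_or => /andP[].
move: i {iA}; apply: (perm4_cases (p := w.2)); rewrite ?eqxx // => _ _.
  by exists w => //; left.
exists (back w); rewrite ?orbit_back //; right.
by rewrite flag_facet_back oppK flag_facet_mirror backK.
Qed.

(** The orbit of x is a cycle, in which the step from x to turn x is missing in G.
    Therefore turn x can only be joined to x by going the whole way round,
    which requires all the other gluings. *)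
Lemma dglued_orbit G x : opp_closed G -> flag_facet x \notin G ->
  connect (dglued G) (flag_dedge x) (flag_dedge (turn x)) <->
  (forall w, w \in porbit turnp x -> w != x -> flag_facet w \in G).
Proof.
(* The forward steps across gluings in G. A path which turns backward at turn x
   would begin with the missing step. *)
move=> Gopp xG; pose r : rel flag := fun w w' => (flag_facet w \in G) && (w' == turn w).
have rO w : connect r (turn x) w -> w \in porbit turnp x.
  move: w; apply: connect_ind => [|w w' _ xw /andP[_ /eqP->]].
    by rewrite orbit_turn porbit_id.
  by rewrite orbit_turn.
split=> [|wG].
  rewrite (dglued_csym Gopp) => cn.
  have [w xw /esym/(flag_dedge_orbit_inj (rO w xw)) wx] :
      exists2 w, connect r (turn x) w & flag_dedge x = flag_dedge w.
    move: (flag_dedge x) cn; apply: connect_ind => [|_ y _ [w xw ->]]; first by exists (turn x).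
    case/dglued_flag_dedge=> -[wG ->].
      by exists (turn w) => //; apply: connect_trans xw (connect1 _); rewrite /r wG /=.
    exists (back w) => //; case/connectP: (xw) => p; elim/last_ind: p => [|p w' _] /=.
      by move=> _ ew; rewrite ew flag_facet_mirror_turn in wG; rewrite -(oppK (flag_facet x)) Gopp in xG.
    rewrite rcons_path last_rcons => /andP[pp /andP[lG /eqP->]] ->.
    by rewrite turnK; apply/connectP; exists p.
  rewrite {w}wx in xw => w ow wx.
  (* Going around from x, each flag can still reach x forward; unless it is x
     itself, the first step of its path crosses a gluing in G. *)
  have [cw] : connect r w x /\ (w != x -> flag_facet w \in G).
    move: w ow {wx}; apply: orbit_ind => [|w _ [cw _]]; first by rewrite eqxx.
    have E w' : connect r w' x -> w' != x -> flag_facet w' \in G /\ connect r (turn w') x.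
      case/connectP=> -[|y p] /=; first by move=> _ ->; rewrite eqxx.
      by case/andP=> /andP[w'G /eqP->] pp px _; split=> //; apply/connectP; exists p.
    have cr : connect r (turn w) x.
      by have [->//|/(E _ cw)[]] := eqVneq w x.
    by split=> // /(E _ cr)[].
  exact.
rewrite (dglued_csym Gopp).
have rG w : connect r (turn x) w -> connect (dglued G) (flag_dedge (turn x)) (flag_dedge w).
  move: w; apply: connect_ind => // w w' _ xw /andP[wG' /eqP->].
  exact: connect_trans xw (connect1 (dglued_turn wG')).
apply: rG; apply: contraT => nx.
have : connect r (turn x) x; last by rewrite (negPf nx).
suff all w : w \in porbit turnp (turn x) -> connect r (turn x) w.
  by apply: all; rewrite porbit_sym orbit_turn porbit_id.
move: w; apply: orbit_ind => // w _ cw; apply: connect_trans (cw) (connect1 _).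
rewrite /r eqxx andbT wG //; first exact: (rO w cw).
by apply: contraNneq nx => wx; rewrite -{2}wx.
Qed.

End Flags.
Notation mirror := (relabel tp23).

(** * Folds as elementary collapses *)

Section Folds.
Variable T : triangulation.
Local Notation S := (simplices T).
Local Notation cls := (class (K := T) setT).
Local Notation turnp := (turnp T).
Implicit Types (c d : cell T) (f : facet T) (G : {set facet T}) (x w : flag T).

(** The triangles without side in G form a 2-complex, and e is a free edge of it:
    among them only Sigma contains e, and only once. *)
Definition free_edge G (e Sigma : simplex T) : Prop :=
  [/\ e \in S 1, contained e Sigma, ~~ repeated_face e Sigma,
      exists2 f, triangle f = Sigma & f \notin G
    & forall f, contained e (triangle f) -> triangle f != Sigma -> f \in G].

Lemma sides_closed (D : {set simplex T}) : opp_closed (sides D).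
Proof. by move=> f; rewrite !inE triangle_opp. Qed.

Lemma flag_exists f a b : a != b -> a != f.2 -> b != f.2 ->
  exists x, flag_facet x = f /\ flag_dedge x = (f.1, (a, b)).
Proof.
move=> ab af bf; have [p [p0 p1 p2]] := perm4_exists ab af bf.
by exists (f.1, p); rewrite /flag_facet /flag_dedge /= p0 p1 p2; case: f {af bf p2}.
Qed.

Lemma flag_of_edge t a b : a != b -> exists x : flag T, flag_dedge x = (t, (a, b)).
Proof.
move=> ab; have [i [ia ib _]] := ord4_avoid3 a b b.
have [||x [_ xd]] := @flag_exists (t, i) a b ab; rewrite 1?eq_sym //.
by exists x.
Qed.

Lemma flag_edge_flag_facet x : (flag_edge x).2 \subset [set~ (flag_facet x).2].
Proof. by rewrite subUset !sub1set !inE !(inj_eq perm_inj). Qed.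

Lemma contained_flag_facet x : contained (cls (flag_edge x)) (triangle (flag_facet x)).
Proof. exact: class_contained (flag_edge_flag_facet x). Qed.

Lemma flag_edge_S1 x : cls (flag_edge x) \in S 1.
Proof. by apply: edge_S1; rewrite (inj_eq perm_inj). Qed.

(** Both sides say that the facet of x is the only one not in G around the edge of
    x: by the orbit of x, and by the triangles of T. They agree because a
    triangle which contains the edge once meets its orbit once. *)
Lemma free_orbit G x : opp_closed G -> flag_facet x \notin G ->
  (forall w, w \in porbit turnp x -> w != x -> flag_facet w \in G) <->
  free_edge G (cls (flag_edge x)) (triangle (flag_facet x)).
Proof.
move=> Gopp xG; have oxG : opp (flag_facet x) \notin G by apply: contra xG => /Gopp; rewrite oppK.
split=> [wG|[_ _ nrep _ eG] w xw wx].
  have wx w : w \in porbit turnp x -> flag_facet w \notin G -> w = x.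
    by move=> xw; apply: contraNeq; exact: wG.
  split; [exact: flag_edge_S1 | exact: contained_flag_facet | | by exists (flag_facet x) |].
  (* The facet at any occurrence of the edge in Sigma is not in G, so the
     occurrence is that of x. *)
  - have uni (A : {set 'I_4}) : A \subset [set~ x.2 o2] -> cls (flag_edge x) = cls (x.1, A) -> A = (flag_edge x).2.
      move=> sA EA; have xA : x.2 o2 \notin A by apply/negP => /(subsetP sA); rewrite !inE eqxx.
      have tA : (x.1, A) \in cls (flag_edge x) by rewrite EA mem_class.
      have [w xw [[wf wc]|[wf wc]]] := facet_around tA xA.
        by rewrite -(wx w xw) ?wc //; rewrite wf.
      have : flag_facet w = opp (flag_facet x) by rewrite -(oppK (flag_facet w)) wf.
      move=> wo; have wE : w = x by apply: wx => //; rewrite wo.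
      by have := opp_neq (flag_facet x); rewrite -wo wE eqxx.
    apply/negP => /(repeated_class (flag_edge_S1 x)) [A [B [AB sA sB EA EB]]].
    by rewrite (uni A sA EA) (uni B sB EB) eqxx in AB.
  - move=> f ef fx; have [a [b [ab af bf eE]]] := edge_triangle (flag_edge_S1 x) ef.
    have tA : (f.1, [set a; b]) \in cls (flag_edge x) by rewrite eE mem_class.
    have iA : f.2 \notin [set a; b] by rewrite !inE negb_or ![f.2 == _]eq_sym af bf.
    have [w xw fw] := facet_around tA iA.
    rewrite -surjective_pairing in fw.
    have nwx : w != x.
      by apply: contraNneq fx => wE; move: fw; rewrite wE => -[[<- _]|[<- _]]; rewrite ?triangle_opp.
    have := wG w xw nwx; case: fw => -[fw _]; first by rewrite fw.
    by move/Gopp; rewrite fw.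
have ew : contained (cls (flag_edge x)) (triangle (flag_facet w)).
  by rewrite -(cls_orbit xw) contained_flag_facet.
have uni (A : {set 'I_4}) : A \subset [set~ x.2 o2] -> cls (flag_edge x) = cls (x.1, A) -> A = (flag_edge x).2.
  move=> sA EA; apply: contraNeq nrep => nA; rewrite eq_sym in nA.
  exact: class_repeated nA (flag_edge_flag_facet x) sA EA.
have [tw|] := eqVneq (triangle (flag_facet w)) (triangle (flag_facet x)); last exact: eG.
case: (triangle_eq tw) => wf.
  have [w1 w2] := wf; case/eqP: wx; apply: flag_edge_orbit_inj => //.
  rewrite [LHS]surjective_pairing [RHS]surjective_pairing; congr (_, _) => //.
  apply: uni; first by rewrite -w2 flag_edge_flag_facet.
  by rewrite -w1 -(cls_orbit xw).
have xw' : turn w \in porbit turnp x by rewrite orbit_turn.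
have : flag_facet (mirror (turn w)) = flag_facet x by rewrite flag_facet_mirror_turn wf oppK.
rewrite flag_facet_mirror => tE; have w1 : (turn w).1 = x.1 := congr1 fst tE.
have w2 : (turn w).2 o3 = x.2 o2 := congr1 snd tE.
have wE : turn w = x.
  apply: flag_edge_orbit_inj => //.
  rewrite [LHS]surjective_pairing [RHS]surjective_pairing; congr (_, _) => //.
  apply: uni; first by rewrite -w2 subUset !sub1set !inE !(inj_eq perm_inj).
  by rewrite -w1 -(cls_orbit xw').
by move: w2; rewrite wE => /perm_inj.
Qed.

(** Two boundary triangles share the edge sigma in T_G exactly when the rotation
    joins their corners inside G, that is, when the image of sigma in T is a
    free edge. *)
Lemma fold_free G s Sigma : opp_closed G -> fold G s Sigma ->
  exists2 x, s = class G (flag_edge x) & free_edge G (cls (flag_edge x)) Sigma.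
Proof.
move=> Gopp /existsP[f /existsP[a /existsP[b H]]].
case/and5P: H => fG ofG /eqP<- ab /and4P[af bf /eqP-> cn].
have [x [xf [x1 xa xb]]] := flag_exists ab af bf.
have ex : flag_edge x = (f.1, [set a; b]) by rewrite /flag_edge x1 xa xb.
exists x; first by rewrite ex.
rewrite -xf; rewrite -xf in fG; apply/(free_orbit Gopp fG)/(dglued_orbit Gopp fG).
by rewrite /turn flag_dedge_mirror /flag_dedge /= !permM; move: cn; rewrite -xf /= xa xb.
Qed.

Lemma free_fold G e Sigma : opp_closed G -> free_edge G e Sigma ->
  exists2 x, e = cls (flag_edge x) & fold G (class G (flag_edge x)) Sigma.
Proof.
move=> Gopp fr; have [e1 eS _ [f fS fG] _] := fr.
rewrite -{}fS in fr eS *; have [a [b [ab af bf eE]]] := edge_triangle e1 eS.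
have [x [xf xd]] := flag_exists ab af bf; have [x1 xa xb] := xd.
have ex : flag_edge x = (f.1, [set a; b]) by rewrite /flag_edge x1 xa xb.
exists x; first by rewrite ex.
have fxG : flag_facet x \notin G by rewrite xf.
have /(free_orbit Gopp fxG)/(dglued_orbit Gopp fxG) : free_edge G (cls (flag_edge x)) (triangle (flag_facet x)).
  by rewrite ex -eE xf.
rewrite /turn flag_dedge_mirror {2}/flag_dedge /= !permM xd => cn.
apply/existsP; exists f; apply/existsP; exists a; apply/existsP; exists b.
rewrite fG (contra (Gopp (opp f))) ?oppK // eqxx ab af bf ex eqxx /=.
by move: cn; rewrite xa xb -xf.
Qed.

Lemma fold_edge_sub G x : class G (flag_edge x) \subset cls (flag_edge x).
Proof.
apply/subsetP => c; rewrite !inE; move: c; apply: connect_ind => // c d _ xc cd.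
apply: connect_trans xc (connect1 _); case/gluedP: cd => i [_ ? ?].
by apply/gluedP; exists i; rewrite inE.
Qed.

(** An edge of T_G lies in a single edge of T, so that the inclusions which define
    the critical tree compare edges of T. *)
Lemma fold_edge_subE G x e : e \in S 1 -> (class G (flag_edge x) \subset e) = (e == cls (flag_edge x)).
Proof.
move=> e1; apply/idP/eqP=> [/subsetP sub|->]; last exact: fold_edge_sub.
by have [] := simplex_class e1 (sub _ (mem_class G (flag_edge x))).
Qed.

(** A local construction seen in T: each edge is free once the previous triangles
    have been removed. Unlike sigma in a fold, e is an edge of T here. *)
Fixpoint collapse G (s : seq (simplex T * simplex T)) : Prop :=
  if s is p :: s' then free_edge G p.1 p.2 /\ collapse (G :|: sides [set p.2]) s'
  else G = setT.

Lemma setU_closed G G' : opp_closed G -> opp_closed G' -> opp_closed (G :|: G').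
Proof. by move=> h h' f; rewrite !inE => /orP[/h->|/h'->]; rewrite ?orbT. Qed.

Definition uncollapsed (s : seq (simplex T * simplex T)) : {set simplex T} :=
  [set e in S 1 | e \notin unzip1 s].
Definition unfolded (s : seq (simplex T * simplex T)) : {set simplex T} :=
  [set e in S 1 | all (fun p : simplex T * simplex T => ~~ (p.1 \subset e)) s].

Lemma folds_collapse G s : opp_closed G -> folds G s ->
  exists2 s', collapse G s' & unfolded s = uncollapsed s'.
Proof.
elim: s G => [|[sg Sg] s IH] G Gopp /=.
  by move/eqP->; exists [::] => //; apply/setP => e; rewrite !inE.
case/andP=> /(fold_free Gopp)[x -> fr] /IH.
case=> [|s' cs' es']; first exact/setU_closed/sides_closed.
exists ((cls (flag_edge x), Sg) :: s') => //; apply/setP => e; move/setP: es' => /(_ e).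
rewrite !in_set /= in_cons; case e1: (e \in S 1) => //=.
by rewrite fold_edge_subE // negb_or => ->.
Qed.

Lemma collapse_folds G s : opp_closed G -> collapse G s ->
  exists2 s', folds G s' & unfolded s' = uncollapsed s.
Proof.
elim: s G => [|[e Sg] s IH] G Gopp /=.
  by move->; exists [::] => //=; apply/setP => e; rewrite !inE.
case=> /(free_fold Gopp)[x -> fo] /IH.
case=> [|s' cs' es']; first exact/setU_closed/sides_closed.
exists ((class G (flag_edge x), Sg) :: s') => /=; first by rewrite fo.
apply/setP => e'; move/setP: es' => /(_ e').
rewrite !in_set /= in_cons; case e1: (e' \in S 1) => //=.
by rewrite fold_edge_subE // negb_or => ->.
Qed.

End Folds.

(** * The Euler inequality for a triangulation *)

Section Euler.
Variable T : triangulation.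
Local Notation S := (simplices T).
Local Notation cls := (class (K := T) setT).
Local Notation turnp := (turnp T).
Local Notation N := #|tet T|.
Implicit Types (f : facet T) (x w : flag T).

Notation tp13 := (tperm o1 o3).
Notation cyc := (tp23 * tp13)%g.

Lemma cyc3 : (cyc * (cyc * cyc))%g = 1%g :> {perm 'I_4}.
Proof.
by apply: perm4_eq; rewrite perm1 !permM !permE.
Qed.

Lemma spin_inj : injective (relabel cyc : flag T -> flag T).
Proof. by move=> [t p] [u q] [-> /mulgI->]. Qed.
(** Turns around the marked vertex within a tetrahedron; its orbits are the
    triangles of the vertex links. *)
Definition spinp : {perm flag T} := perm spin_inj.

Lemma flip_invol : involutive (fun x : flag T => relabel tp13 (cross x)).
Proof.
move=> x; rewrite -relabel_cross ?tpermD // crossK relabelM tperm2.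
by case: x => t p; rewrite /relabel mul1g.
Qed.
(** Crosses the marked facet, keeping it marked; its orbits are the edges of the
    vertex links. *)
Definition flipp : {perm flag T} := perm (inv_inj flip_invol).

(** The vertices of the links, which are the ends of the edges of T, are the
    orbits of the rotation around an edge. *)
Lemma flip_spin : (flipp * spinp)%g = turnp.
Proof.
apply/permP => x; rewrite permM !permE relabelM -mulgA tperm2 mulg1.
by [].
Qed.

Lemma card_flag : #|flag T| = N * 24.
Proof. by rewrite card_prod card_Sn. Qed.

(** There are 4 N facets, and at most two of them on each triangle. *)
Lemma card_triangles : N.*2 <= #|S 2|.
Proof.
have : #|facet T| <= #|S 2| * 2.
  rewrite -[#|facet T|]sum1_card (partition_big (@triangle T) [in S 2]) /= => [|f _]; last exact: triangle_S2.
  rewrite -sum_nat_const; apply: leq_sum => s /triangleP[f ->]; rewrite sum1_card.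
  have sub : [pred f' | triangle f' == triangle f] \subset [set f; opp f].
    by apply/subsetP => f'; rewrite !inE => /eqP/triangle_eq[]->; rewrite eqxx ?orbT.
  by apply: leq_trans (subset_leq_card sub) _; rewrite cards2; case: (_ != _).
by rewrite card_prod card_ord; lia.
Qed.

Lemma edge_flag e : e \in S 1 -> exists x, cls (flag_edge x) = e.
Proof.
case/edgeP=> t [a [b [ab ->]]]; have [x [x1 xa xb]] := flag_of_edge t ab.
by exists x; rewrite /flag_edge x1 xa xb.
Qed.

(** An edge of T carries at least four orbits: it has two directions, and each has
    two sides. *)
Lemma card_turn_orbits : #|S 1| * 4 <= #|porbits turnp|.
Proof.
have [|xe xeP] := @fin_all_exists {e : simplex T | e \in S 1} (fun=> flag T)
  (fun e x => cls (flag_edge x) = val e); first by case=> e /= /edge_flag.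
(* q exchanges the ends of the edge, or the two facets around it. *)
pose q (b b' : bool) : {perm 'I_4} :=
  ((if b then tperm o0 o1 else 1) * (if b' then tp23 else 1))%g.
pose y (k : {e : simplex T | e \in S 1} * (bool * bool)) := relabel (q k.2.1 k.2.2) (xe k.1).
have yE k : flag_edge (y k) = flag_edge (xe k.1).
  case: k => e [b b']; rewrite /flag_edge /y /q /= !permM; congr (_, _); apply/setP => i; rewrite !inE.
  by case: b; case: b'; rewrite ?perm1 ?tpermL ?tpermR ?[tp23 _]tpermD // orbC.
have y_inj : injective (fun k => porbit turnp (y k)).
  move=> k k' /esym/eqP; rewrite eq_porbit_mem => kk'.
  have ek : k.1 = k'.1.
    by apply: val_inj; have := cls_orbit kk'; rewrite !yE !xeP.
  have := flag_edge_orbit_inj kk'; rewrite !yE ek => /(_ erefl).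
  case: k k' ek {kk'} => [e [b b']] [_ [c c']] /= <-; rewrite /y /relabel /= => -[/mulIg Q].
  congr (_, (_, _)).
    have := congr1 (fun p : {perm 'I_4} => p o0) Q; rewrite /q !permM.
    by case: b {Q}; case: c; rewrite ?perm1 ?tpermL; case: b'; case: c'; rewrite ?perm1 ?[tp23 _]tpermD.
  have := congr1 (fun p : {perm 'I_4} => p o2) Q; rewrite /q !permM.
  by case: b {Q}; case: c; rewrite ?perm1 ?[tperm o0 _ _]tpermD //; case: b'; case: c'; rewrite ?perm1 ?tpermL.
have <- : #|{: {e : simplex T | e \in S 1} * (bool * bool)}| = #|S 1| * 4.
  by rewrite !card_prod card_bool card_sig.
rewrite -(card_codom y_inj); apply/subset_leq_card/subsetP => _ /codomP[k ->].
exact: imset_f.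
Qed.

(** Any two flags at the same vertex are linked up to a mirror image, because the
    tetrahedra around a vertex are linked by gluings of facets and these can
    all be crossed by spinning and flipping. *)
Lemma card_vertex_components :
  #|roots (joined flipp spinp)| <= (#|S 0|).*2.
Proof.
pose vt x := cls (x.1, [set x.2 o0]).
have [|xv xvP] := @fin_all_exists {v : simplex T | v \in S 0} (fun=> flag T)
  (fun v x => vt x = val v).
  case=> v /= /vertexP[t [a ->]]; exists (t, tperm o0 a).
  by rewrite /vt /= tpermL.
have <- : #|{: {v : simplex T | v \in S 0} * bool}| = (#|S 0|).*2.
  by rewrite !card_prod card_bool card_sig muln2.
pose C := connect (joined flipp spinp); have Cs : symmetric C := joined_sym _ _.
apply: (components_le (h := fun vb => if vb.2 then relabel tp13 (xv vb.1) else xv vb.1)); first exact: joined_sym.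
move=> x; have v0 : vt x \in S 0 by exact: vertex_S0.
set v : {v : simplex T | v \in S 0} := Sub (vt x) v0; pose z := xv v.
suff: C z x \/ C (relabel tp13 z) x by case; [exists (v, false) | exists (v, true)].
have C1 w : C w (relabel cyc w) by have := joinedr flipp spinp w; rewrite permE.
have C2 w : C w (relabel cyc (relabel cyc w)) := connect_trans (C1 _) (C1 _).
have C3 w : C w (relabel tp13 (cross w)) by have := joinedl flipp spinp w; rewrite permE.
have spin w i : i != w.2 o0 -> exists u, [/\ C w u, u.1 = w.1, u.2 o0 = w.2 o0 & u.2 o2 = i].
  move: i; apply: (perm4_cases (p := w.2)); rewrite ?eqxx // => _.
  - by exists (relabel cyc w); rewrite C1 !permM !permE.
  - by exists w; rewrite /C connect0.
  - by exists (relabel cyc (relabel cyc w)); rewrite C2 !permM !permE.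
(* Stated for the cells of the vertex, to be spread along the gluings: the flags
   at such a cell are reached from z or from its mirror image. *)
pose good (c : cell T) := forall w, (w.1, [set w.2 o0]) = c -> C z w \/ C (relabel tp13 z) w.
suff: good (x.1, [set x.2 o0]) by apply.
have : (x.1, [set x.2 o0]) \in vt z by rewrite xvP mem_class.
rewrite inE; move: (x.1, _); apply: connect_ind => [w [w1 /set1_inj w0]|c d _ gc /gluedP[i [_ ic ->]] w].
  have [|u [wu u1 u0 u2]] := spin w (z.2 o2); first by rewrite w0 (inj_eq perm_inj).
  rewrite w0 in u0; rewrite w1 in u1; case: u wu u1 u0 u2 => [t p] /= wu tz p0 p2.
  rewrite {t}tz in wu; have [p1|p1] := eqVneq (p o1) (z.2 o1).
    by left; rewrite Cs (_ : z = (z.1, p)) //; case: (z) p0 p1 p2 => t q /= *; congr (_, _); exact: perm4_eq.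
  right; rewrite Cs (_ : relabel _ _ = (z.1, p)) //; congr (_, _); apply/esym/perm4_eq; rewrite permM ?tpermL ?tpermD //.
  apply: (@perm4_cases z.2 (fun i => p o1 = i -> i = z.2 o3)) (erefl _) => //.
  - by rewrite -p0 => /perm_inj.
  - by move=> e; rewrite e eqxx in p1.
  - by rewrite -p2 => /perm_inj.
case=> w1 E; set g := gmap c.1 i in E.
have Ec : c.2 = [set (g^-1)%g (w.2 o0)] by rewrite -(imset_permK g c.2) -E imset_set1.
have iw : g i != w.2 o0.
  by move: ic; rewrite Ec inE; apply: contra => /eqP<-; rewrite permK.
have [u [wu u1 u0 u2]] := spin w (g i) iw.
have := gc (relabel tp13 (cross u)); rewrite /= permM tpermD // permM u1 w1 u2 u0 nbrK gmapK.
case=> [|zu|zu]; first by rewrite -Ec; case: (c).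
  by left; rewrite Cs; apply: connect_trans wu (connect_trans (C3 u) _); rewrite -/(C _ _) Cs.
by right; rewrite Cs; apply: connect_trans wu (connect_trans (C3 u) _); rewrite -/(C _ _) Cs.
Qed.

(** The inequality says that the vertex links, which are closed surfaces, have
    nonnegative total genus. They have 4 N triangles, 6 N edges, and 2 #|S 1|
    vertices, and #|S 0| components; flags count all of these twice. *)
Lemma euler_ineq : #|S 1| <= #|S 0| + N.
Proof.
have := genus_ge0 flipp spinp; rewrite flip_spin card_flag.
have := @card_porbits_ge _ flipp 2 isT; have := @card_porbits_ge _ spinp 3 isT.
have := card_turn_orbits; have := card_vertex_components.
rewrite card_flag => h1 h2 h3 h4 h5.
have {}h3 : N * 24 <= 3 * #|porbits spinp|.
  apply: h3; apply/permP => x; rewrite !expgS mulg1 perm1 !permM !permE !relabelM -mulgA cyc3.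
  by case: x => t p; rewrite /relabel mul1g.
have {}h4 : N * 24 <= 2 * #|porbits flipp|.
  by apply: h4; apply/permP => x; rewrite expgS perm1 permM !permE flip_invol.
lia.
Qed.

End Euler.

(** * From gradients to collapses *)

Section Gradients.
Variable T : triangulation.
Local Notation S := (simplices T).
Local Notation cls := (class (K := T) setT).
Local Notation field := {set simplex T * simplex T}.
Implicit Types (L : field) (x y z : simplex T) (t : tet T).

Lemma gradient_pair L x y : morse_gradient L -> (x, y) \in L ->
  exists k, [/\ k < 3, x \in S k, y \in S k.+1 & contained x y].
Proof.
case/andP=> /andP[/forallP/(_ (x, y))/implyP h _] _ /h /existsP[k /and3P[xk yk xy]].
by exists k.
Qed.

Lemma gradient_sub L x y k : morse_gradient L -> (x, y) \in L -> x \in S k -> y \in S k.+1.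
Proof.
by move=> gL /(gradient_pair gL)[l [_ xl yl _]] xk; rewrite (simplex_dim xk xl).
Qed.

Lemma gradient_sup L x y k : morse_gradient L -> (x, y) \in L -> y \in S k.+1 -> x \in S k.
Proof.
by move=> gL /(gradient_pair gL)[l [_ xl yl _]] yk; have [->] := simplex_dim yk yl.
Qed.

Lemma gradient_contained L x y : morse_gradient L -> (x, y) \in L -> contained x y.
Proof. by move=> gL /(gradient_pair gL)[l []]. Qed.

Lemma gradient_unique L p q x : morse_gradient L -> p \in L -> q \in L ->
  x \in [set p.1; p.2] -> x \in [set q.1; q.2] -> p = q.
Proof.
case/andP=> /andP[_ /forallP/(_ p)/implyP h] _ /h/forallP/(_ q)/implyP{}h /h /implyP{}h xp xq.
by apply: contraTeq xq => /h /disjointFr; move/(_ x xp)=> ->.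
Qed.

Lemma gradient_fun L x y z : morse_gradient L -> (x, y) \in L -> (x, z) \in L -> y = z.
Proof.
by move=> gL xy xz; have [] := @gradient_unique L (x, y) (x, z) x gL xy xz (set21 _ _) (set21 _ _).
Qed.

Lemma gradient_inj L x y z : morse_gradient L -> (x, z) \in L -> (y, z) \in L -> x = y.
Proof.
by move=> gL xz yz; have [] := @gradient_unique L (x, z) (y, z) z gL xz yz (set22 _ _) (set22 _ _).
Qed.

Lemma gradient_norep L x y : morse_gradient L -> (x, y) \in L -> ~~ repeated_face x y.
Proof. by case/andP=> _ /andP[_ /forallP/(_ (x, y))/implyP h] /h. Qed.

(** A discrete Morse function: the height drops along the walks of a gradient. *)
Definition height L := below (walk_step L).

Lemma height_ind L (P : simplex T -> Prop) :
  (forall x, (forall y, height L x < height L y -> P y) -> P x) -> forall x, P x.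
Proof.
move=> PS x; have [n] := ubnP (#|simplex T| - height L x).
elim: n x => // n IH x le_n; apply: PS => y xy; apply: IH.
by apply: leq_trans (ltn_sub2l (leq_trans xy (max_card _)) xy) _; rewrite -ltnS.
Qed.

Lemma height_walk L x y : morse_gradient L -> walk_step L x y -> height L y < height L x.
Proof.
case/andP=> _ /andP[/forallP ac _]; apply: below_lt => a b.
by move/forallP: (ac a) => /(_ b)/implyP.
Qed.

Lemma height_up L x y : morse_gradient L -> (x, y) \in L -> height L y < height L x.
Proof. by move=> gL xy; apply: height_walk; rewrite // /walk_step xy. Qed.

Lemma height_down L x y k : morse_gradient L -> k < 3 -> x \in S k.+1 -> y \in S k ->
  contained y x -> (y, x) \notin L -> height L y < height L x.
Proof.
move=> gL k3 xk yk yx nyx; apply: height_walk; rewrite // /walk_step; apply/orP; right.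
by apply/existsP; exists (Ordinal k3); rewrite xk yk yx.
Qed.

Lemma noncritical L x k : k < 4 -> x \in S k -> x \notin critical L ->
  exists2 p, p \in L & x = p.1 \/ x = p.2.
Proof.
move=> k4 xk; rewrite inE negb_and => /orP[/negP[]|].
  by apply/bigcupP; exists (Ordinal k4).
case/forallPn => p; rewrite negb_imply negb_and !negbK => /andP[pL xp].
by exists p => //; case/orP: xp => /eqP; [left | right].
Qed.

Lemma noncritical_vertex L v : morse_gradient L -> v \in S 0 -> v \notin critical L ->
  exists e, (v, e) \in L.
Proof.
move=> gL v0 /(noncritical (isT : 0 < 4) v0)[[x y] xyL /= [vx|vy]]; first by exists y; rewrite vx.
have [k [_ _ yk _]] := gradient_pair gL xyL.
by rewrite vy in v0; have := simplex_dim v0 yk.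
Qed.

Lemma noncritical_tetra L t : morse_gradient L -> tetra t \notin critical L ->
  exists i, (triangle (t, i), tetra t) \in L.
Proof.
move=> gL /(noncritical (isT : 3 < 4) (tetra_S3 t))[[x y] xyL /= [tx|ty]].
  have [k [k3 xk _ _]] := gradient_pair gL xyL; rewrite -tx in xk.
  by have kE := simplex_dim (tetra_S3 t) xk; rewrite -kE in k3.
rewrite -ty in xyL; have x2 : x \in S 2 := gradient_sup gL xyL (tetra_S3 t).
have [i xi] := triangle_tetra x2 (gradient_contained gL xyL).
by exists i; rewrite -xi.
Qed.

Lemma noncritical_edge L e : morse_gradient L -> e \in S 1 -> e \notin critical L ->
  (exists2 v, v \in S 0 & (v, e) \in L) \/ (exists2 s, s \in S 2 & (e, s) \in L).
Proof.
move=> gL e1 /(noncritical (isT : 1 < 4) e1)[[x y] xyL /= [ex|ey]]; [right | left].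
  by rewrite -ex in xyL; exists y => //; apply: gradient_sub xyL e1.
by rewrite -ey in xyL; exists x => //; apply: gradient_sup xyL e1.
Qed.

Lemma noncritical_triangle L s : morse_gradient L -> s \in S 2 -> s \notin critical L ->
  (exists2 e, e \in S 1 & (e, s) \in L) \/ (exists2 t, t \in S 3 & (s, t) \in L).
Proof.
move=> gL s2 /(noncritical (isT : 2 < 4) s2)[[x y] xyL /= [ex|ey]]; [right | left].
  by rewrite -ex in xyL; exists y => //; apply: gradient_sub xyL s2.
by rewrite -ey in xyL; exists x => //; apply: gradient_sup xyL s2.
Qed.

(** The triangle matched with t is left through its other side: gradient walks go
    from the neighbour of t to t, and the neighbour is not t, since the
    triangle is not a repeated face. *)
Lemma gradient_tetra_lt L t i : morse_gradient L -> (triangle (t, i), tetra t) \in L ->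
  height L (tetra t) < height L (tetra (nbr t i)).
Proof.
move=> gL tiL; apply: ltn_trans (height_up gL tiL) _.
apply: (height_down gL (isT : 2 < 3)); rewrite ?tetra_S3 ?triangle_S2 //.
  by rewrite -triangle_opp; exact: tetra_triangle.
apply/negP => tjL; have /tetra_inj tt := gradient_fun gL tjL tiL.
by have := gradient_norep gL tiL; rewrite tetra_repeated.
Qed.

Lemma edge_other_end v e : e \in S 1 -> v \in S 0 -> contained v e -> ~~ repeated_face v e ->
  exists u, [/\ u \in S 0, u != v & contained u e].
Proof.
case/edgeP=> t [a [b [ab ->]]] v0 ve; have C c : c \in [set a; b] -> contained (cls (t, [set c])) (cls (t, [set a; b])).
  by move=> cab; apply: class_contained; rewrite sub1set.
have nab : [set a] != [set b] by apply: contra ab => /eqP/set1_inj->.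
have R : cls (t, [set a]) = cls (t, [set b]) -> repeated_face (cls (t, [set a])) (cls (t, [set a; b])).
  by apply: class_repeated; rewrite ?sub1set ?inE ?eqxx ?orbT.
case: (vertex_edge v0 ve) => ->.
  move=> nr; exists (cls (t, [set b])); split; rewrite ?vertex_S0 ?C ?inE ?eqxx ?orbT //.
  by apply: contra nr => /eqP/esym/R.
move=> nr; exists (cls (t, [set a])); split; rewrite ?vertex_S0 ?C ?inE ?eqxx ?orbT //.
by apply: contra nr => /eqP E; rewrite -{1}E; exact: R.
Qed.

(** A highest tetrahedron cannot be matched, as its triangle would lead to a
    higher one. *)
Lemma critical_tetra L : morse_gradient L -> exists t, tetra t \in critical L.
Proof.
move=> gL; case/card_gt0P: (tet_gt0 T) => t0 _; pose t := [arg max_(u > t0) height L (tetra u)].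
exists t; apply: contraT; rewrite /t; case: arg_maxnP => // {}t _ tmax.
case/(noncritical_tetra gL)=> i /(gradient_tetra_lt gL).
by rewrite ltnNge; have /= -> := tmax (nbr t i) isT.
Qed.

(** A lowest vertex cannot be matched, as the other end of its edge would be
    lower. *)
Lemma critical_vertex L : morse_gradient L -> exists2 v, v \in S 0 & v \in critical L.
Proof.
move=> gL; case/card_gt0P: (tet_gt0 T) => t0 _; have v0 := vertex_S0 t0 o0.
case: (arg_minnP (height L) v0) => v vS vmin; exists v => //; apply: contraT.
case/(noncritical_vertex gL vS)=> e veL; have e1 := gradient_sub gL veL vS.
have [u [uS uv ue]] := edge_other_end e1 vS (gradient_contained gL veL) (gradient_norep gL veL).
have := vmin u uS; rewrite leqNgt (ltn_trans (height_down gL (isT : 0 < 3) e1 uS ue _) (height_up gL veL)) //.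
by apply: contra uv => ueL; rewrite (gradient_inj gL ueL veL).
Qed.

Lemma dual_adj_sym (D : {set simplex T}) : symmetric (dual_adj D).
Proof.
suff sub t u : dual_adj D t u -> dual_adj D u t by move=> t u; apply/idP/idP; exact: sub.
case/existsP=> i /andP[ti /eqP<-]; apply/existsP; exists (gmap t i i).
by rewrite nbrK eqxx andbT; have := triangle_opp (t, i); rewrite /opp /= => ->.
Qed.

Section TwoCritical.
Variable L : field.
Hypotheses (gL : morse_gradient L) (cL : #|critical L| == 2).

(** Every gradient has a critical vertex and a critical tetrahedron, so two
    critical simplices are these. *)
Lemma two_critical : exists v t, v \in S 0 /\ critical L = [set v; tetra t].
Proof.
have [v v0 vc] := critical_vertex gL; have [t tc] := critical_tetra gL.
exists v, t; split=> //; apply/esym/eqP; rewrite eqEcard (eqP cL) cards2 subUset !sub1set vc tc.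
by case: eqP v0 => // -> v0; have := simplex_dim v0 (tetra_S3 t).
Qed.

Lemma not_critical x k : 0 < k < 3 -> x \in S k -> x \notin critical L.
Proof.
move=> k3 xk; have [v [t [v0 ->]]] := two_critical; rewrite !inE negb_or.
apply/andP; split; apply: contraTneq k3 => E; rewrite E in xk.
  by rewrite (simplex_dim xk v0).
by rewrite (simplex_dim xk (tetra_S3 t)).
Qed.

Lemma vertex_treeP e : reflect (exists2 v, v \in S 0 & (v, e) \in L) (e \in vertex_tree L).
Proof.
apply: (iffP imsetP) => [[[v e'] /=]|[v v0 veL]]; first by rewrite inE => /andP[vL v0] ->; exists v.
by exists (v, e) => //; rewrite inE veL.
Qed.

Lemma tet_treeP s : reflect (exists t, (s, tetra t) \in L) (s \in tet_tree L).
Proof.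
apply: (iffP imsetP) => [[[s' t] /=]|[t stL]]; last by exists (s, tetra t); rewrite // inE stL tetra_S3.
by rewrite inE => /andP[stL /tetraP[u tu]] ->; exists u; rewrite -tu.
Qed.

Lemma edge_partP e s : ((e, s) \in edge_part L) = ((e, s) \in L) && (e \in S 1).
Proof. by rewrite inE. Qed.

Lemma edge_matched e : e \in S 1 -> (e \notin vertex_tree L) = [exists s, (e, s) \in edge_part L].
Proof.
move=> e1; apply/idP/existsP => [nv|[s]].
  have [[v v0 ve]|[s _ es]] := noncritical_edge gL e1 (not_critical (isT : 0 < 1 < 3) e1).
    by case/vertex_treeP: nv; exists v.
  by exists s; rewrite edge_partP es.
rewrite edge_partP e1 andbT => esL; apply/vertex_treeP => -[v v0 veL].
have [ve es'] := @gradient_unique L (v, e) (e, s) e gL veL esL (set22 _ _) (set21 _ _).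
by rewrite ve in v0; have := simplex_dim v0 e1.
Qed.

Lemma triangle_matched s : s \in S 2 -> (s \notin tet_tree L) = [exists e, (e, s) \in edge_part L].
Proof.
move=> s2; apply/idP/existsP => [nt|[e]].
  have [[e e1 es]|[t /tetraP[u ->] st]] := noncritical_triangle gL s2 (not_critical (isT : 0 < 2 < 3) s2).
    by exists e; rewrite edge_partP es.
  by case/tet_treeP: nt; exists u.
rewrite edge_partP => /andP[esL e1]; apply/tet_treeP => -[t stL].
have [es' _] := @gradient_unique L (e, s) (s, tetra t) s gL esL stL (set22 _ _) (set21 _ _).
by rewrite es' in e1; have := simplex_dim e1 s2.
Qed.

(** When the highest edges are collapsed first, each of them is free in turn: a
    triangle s', other than its mate, which contains e lies above e, and the
    mate of s' is an edge higher still, so that s' has gone before. *)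
Lemma matching_collapse G (ps : seq (simplex T * simplex T)) :
    opp_closed G -> {subset ps <= edge_part L} -> uniq ps ->
    sorted (fun p q => height L q.1 <= height L p.1) ps ->
    (forall f, f \notin G <-> triangle f \in unzip2 ps) -> collapse G ps.
Proof.
elim: ps G => [|[e s] ps IH] G Gopp sub /= un srt Gps.
  by apply/setP => f; rewrite inE; apply/negbNE/negP => /Gps.
have /sub := mem_head (e, s) ps; rewrite edge_partP => /andP[esL e1].
have s2 := gradient_sub gL esL e1; case/andP: un => esps un.
have nsps : s \notin unzip2 ps.
  apply: contra esps => /mapP[[e' s'] /= eps' ss']; rewrite ss' in esL *.
  have /sub : (e', s') \in (e, s) :: ps by rewrite inE eps' orbT.
  by rewrite edge_partP => /andP[esL' _]; rewrite (gradient_inj gL esL esL').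
split.
  split=> //; [exact: gradient_contained esL | exact: gradient_norep esL | |].
    by have [f sf] := triangleP s2; exists f; rewrite //; apply/Gps; rewrite -sf mem_head.
  move=> f ef fs; apply: contraT => /Gps; rewrite inE (negPf fs) /= => /mapP[[e' s'] eps' /= sf].
  have /sub : (e', s') \in (e, s) :: ps by rewrite inE eps' orbT.
  rewrite edge_partP => /andP[esL' _].
  have trp : transitive (fun p q : simplex T * simplex T => height L q.1 <= height L p.1).
    by move=> p q r h1 h2; exact: leq_trans h2 h1.
  have /allP/(_ _ eps') /= := order_path_min trp srt.
  have lt1 : height L e < height L (triangle f).
    apply: (height_down gL (isT : 1 < 3)) => //; first exact: triangle_S2.
    by apply: contra fs => efL; rewrite (gradient_fun gL efL esL).
  by rewrite leqNgt (ltn_trans lt1) // sf; exact: height_up.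
apply: IH => //; first exact/setU_closed/sides_closed.
- by move=> p pps; apply: sub; rewrite inE pps orbT.
- exact: path_sorted srt.
move=> f; rewrite !inE negb_or; split=> [/andP[/Gps]|fps].
  by rewrite inE => /orP[->|].
rewrite (introT negP) /=; last by move=> fG; case/negP: (iffRL (Gps f) (mem_behead (s := s :: _) fps)).
by apply: contra nsps => /eqP<-.
Qed.

Lemma gradient_collapse : exists2 s, collapse (sides (tet_tree L)) s & uncollapsed s = vertex_tree L.
Proof.
pose r (p q : simplex T * simplex T) := height L q.1 <= height L p.1.
have mem_s p : (p \in sort r (enum (edge_part L))) = (p \in edge_part L) by rewrite mem_sort mem_enum.
exists (sort r (enum (edge_part L))).
  apply: matching_collapse; first exact: sides_closed.
  - by move=> p; rewrite mem_s.
  - by rewrite sort_uniq enum_uniq.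
  - by apply: sort_sorted => p q; exact: leq_total.
  move=> f; rewrite inE triangle_matched ?triangle_S2 //.
  split=> [/existsP[e ef]|/mapP[[e s] /=]]; first by apply/mapP; exists (e, triangle f); rewrite ?mem_s.
  by rewrite mem_s => es ->; apply/existsP; exists e.
apply/setP => e; rewrite inE; apply/andP/idP => [[e1]|ev].
  apply: contraR; rewrite (edge_matched e1) => /existsP[s es].
  by apply/mapP; exists (e, s); rewrite ?mem_s.
have e1 : e \in S 1 by case/vertex_treeP: ev => v v0 veL; exact: gradient_sub veL v0.
split=> //; apply: contraL ev => /mapP[[e' s] /=]; rewrite mem_s => es ee'.
by rewrite (edge_matched e1); apply/existsP; exists s; rewrite ee'.
Qed.

(** A noncritical tetrahedron is linked to a higher one, its parent, which gives
    the paths to the critical tetrahedron. Removing the triangle between t and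
    its parent cuts off the descendants of t, since each triangle of the tree
    links a child to its parent. *)
Lemma tet_tree_spanning : dual_spanning_tree (tet_tree L).
Proof.
apply/and3P; split.
- apply/subsetP => s /tet_treeP[t stL]; exact: gradient_sup stL (tetra_S3 t).
- have [v [t0 [v0 cE]]] := two_critical.
  have to0 t : connect (dual_adj (tet_tree L)) t t0.
    move xE: (tetra t) => x; elim/(height_ind (L := L)): x t xE => x IH t tx; subst x.
    have [->|tt0] := eqVneq t t0; first exact: connect0.
    have [|i tiL] := @noncritical_tetra L t gL.
      rewrite cE !inE negb_or (inj_eq (@tetra_inj T)) tt0 andbT.
      by apply: contraTneq v0 => <-; apply/negP => t_0; have := simplex_dim (tetra_S3 t) t_0.
    apply: (@connect_trans _ _ (nbr t i)).
      apply: connect1; apply/existsP; exists i; rewrite eqxx andbT.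
      by apply/tet_treeP; exists t.
    by apply: IH (erefl _); exact: gradient_tetra_lt.
  apply/forallP => t; apply/forallP => u; apply: connect_trans (to0 t) _.
  by rewrite (sym_connect_sym (@dual_adj_sym _)).
apply/forallP => f; apply/implyP => /tet_treeP[t ftL].
have [i fE] := triangle_tetra (triangle_S2 f) (gradient_contained gL ftL).
rewrite fE in ftL *.
(* R links a tetrahedron to its parent. *)
pose R : rel (tet T) := fun u w => [exists j, ((triangle (u, j), tetra u) \in L) && (w == nbr u j)].
have Rlt u w : R u w -> height L (tetra u) < height L (tetra w).
  by case/existsP=> j /andP[ujL /eqP->]; exact: gradient_tetra_lt.
have desc u w : connect R u w -> height L (tetra u) <= height L (tetra w).
  by move: w; apply: connect_ind => // a b _ ua /Rlt/ltnW; exact: leq_trans.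
(* The set of the descendants of t is closed under the remaining links. *)
have step u w : dual_adj (tet_tree L :\ triangle (t, i)) u w -> connect R u t -> connect R w t.
  case/existsP=> j /andP[]; rewrite !inE => /andP[ujt /tet_treeP[z ujL]] /eqP<- ut.
  have [k] := triangle_tetra (triangle_S2 _) (gradient_contained gL ujL).
  case/triangle_eq=> [[uz _]|ujE]; last first.
    rewrite ujE triangle_opp in ujL; have [uE _] := ujE.
    have -> : nbr u j = z by have := congr1 (@opp T) ujE; rewrite oppK => -[].
    by apply: connect_trans ut; apply: connect1; apply/existsP; exists k; rewrite ujL uE eqxx.
  rewrite -{z}uz in ujL; case/connectP: ut => -[|w' p] /=.
    by move=> _ tu; rewrite tu in ujL ftL ujt; rewrite (gradient_inj gL ujL ftL) eqxx in ujt.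
  case/andP=> /existsP[j' /andP[uj'L /eqP->]] pp pt.
  have [[->]|ujE] := triangle_eq (gradient_inj gL ujL uj'L); first by apply/connectP; exists p.
  have := gradient_norep gL uj'L; rewrite tetra_repeated //.
  by have := congr1 fst ujE.
have adjR w : connect (dual_adj (tet_tree L :\ triangle (t, i))) t w -> connect R w t.
  by move: w; apply: connect_ind => // a b _ ta ab; exact: step ab ta.
have nadj : ~~ connect (dual_adj (tet_tree L :\ triangle (t, i))) t (nbr t i).
  apply/negP => /adjR/desc; rewrite leqNgt (gradient_tetra_lt gL) //.
case: (triangle_eq fE) => -> //=.
by rewrite nbrK (sym_connect_sym (@dual_adj_sym _)).
Qed.

End TwoCritical.

(** Two different matchings of the same edges with the same triangles never stop
    climbing: if L matches e with s and L' matches it with s', then L matches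
    s' with an edge e' which is higher than e, and L' matches e' with yet
    another triangle. *)
Lemma matching_unique L L' : morse_gradient L -> #|critical L| == 2 ->
    morse_gradient L' -> #|critical L'| == 2 ->
    vertex_tree L = vertex_tree L' -> tet_tree L = tet_tree L' ->
  edge_part L = edge_part L'.
Proof.
move=> gL cL gL' cL' vE tE.
have same e s s' : (e, s) \in edge_part L -> (e, s') \in edge_part L' -> s = s'.
  elim/(height_ind (L := L)): e s s' => e IH s s' es es'.
  apply: contraTeq isT => ss'.
  have [esL e1] := andP (etrans (esym (edge_partP L e s)) es).
  have [esL' _] := andP (etrans (esym (edge_partP L' e s')) es').
  have s'2 := gradient_sub gL' esL' e1.
  have : s' \notin tet_tree L by rewrite tE (triangle_matched gL' cL') //; apply/existsP; exists e.
  rewrite (triangle_matched gL cL) // => /existsP[e' e's'].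
  have [e'sL e'1] := andP (etrans (esym (edge_partP L e' s')) e's').
  have : e' \notin vertex_tree L' by rewrite -vE (edge_matched gL cL) //; apply/existsP; exists s'.
  rewrite (edge_matched gL' cL') // => /existsP[s'' e's''].
  have [e'sL' _] := andP (etrans (esym (edge_partP L' e' s'')) e's'').
  have lt_e : height L e < height L e'.
    apply: ltn_trans (height_up gL e'sL).
    apply: (height_down gL (isT : 1 < 3)) => //; first exact: gradient_contained esL'.
    by apply: contra ss' => esL2; rewrite (gradient_fun gL esL esL2).
  have ss'' : s' = s'' := IH e' lt_e _ _ e's' e's''.
  have ee : e = e' by rewrite -ss'' in e'sL'; exact: gradient_inj gL' esL' e'sL'.
  by rewrite ee ltnn in lt_e.
have subm (M M' : field) : morse_gradient M -> #|critical M| == 2 -> morse_gradient M' -> #|critical M'| == 2 ->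
    vertex_tree M = vertex_tree M' ->
    (forall e s s', (e, s) \in edge_part M -> (e, s') \in edge_part M' -> s = s') ->
  edge_part M \subset edge_part M'.
  move=> gM cM gM' cM' vM h; apply/subsetP => -[e s] es.
  have e1 : e \in S 1 by move: es; rewrite edge_partP => /andP[].
  have : e \notin vertex_tree M' by rewrite -vM (edge_matched gM cM) //; apply/existsP; exists s.
  by rewrite (edge_matched gM' cM') // => /existsP[s' es']; rewrite (h _ _ _ es es').
apply/eqP; rewrite eqEsubset !subm // => e s s' es es'.
exact/esym/(same e).
Qed.

End Gradients.

(** * Collapses and the 1-skeleton *)

Section Collapses.
Variable T : triangulation.
Local Notation S := (simplices T).
Local Notation cls := (class (K := T) setT).
Implicit Types (G : {set facet T}) (s : seq (simplex T * simplex T)).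

Lemma collapse_mem G s e Sg : collapse G s -> (e, Sg) \in s ->
  [/\ e \in S 1, Sg \in S 2, contained e Sg, ~~ repeated_face e Sg
    & exists2 f, triangle f = Sg & f \notin G].
Proof.
elim: s G => //= p s IH G [fr cs]; rewrite inE => /orP[/eqP pE|/(IH _ cs)[? ? ? ? [f fS]]].
  move: fr; rewrite -pE /= => -[? ? ? [f fS fG] _].
  by split=> //; [rewrite -fS triangle_S2 | exists f].
by rewrite inE negb_or => /andP[fG _]; split=> //; exists f.
Qed.

Lemma collapse_cover G s f : collapse G s -> f \notin G -> triangle f \in unzip2 s.
Proof.
elim: s G => [|p s IH] G /=; first by move->; rewrite inE.
case=> _ cs fG; rewrite inE; have [//|fp] := eqVneq.
by apply: IH cs _; rewrite !inE negb_or fG fp.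
Qed.

Lemma free_used G e Sg Sg' f : free_edge G e Sg -> contained e Sg' ->
  triangle f = Sg' -> f \notin G -> Sg' = Sg.
Proof. by case=> _ _ _ _ h eS fS; apply: contraNeq => nS; apply: h; rewrite fS. Qed.

Lemma collapse_used G p s e Sg : collapse G (p :: s) -> (e, Sg) \in s ->
  contained p.1 Sg = false /\ Sg != p.2.
Proof.
case=> /= fr cs /(collapse_mem cs)[_ _ _ _ [f fS]]; rewrite !inE negb_or fS => /andP[fG nS].
split=> //; apply: contraNF nS => pS; exact/eqP/(free_used fr pS fS).
Qed.

Lemma collapse_uniq G s : collapse G s -> uniq (unzip1 s) /\ uniq (unzip2 s).
Proof.
elim: s G => //= p s IH G cps; have [fr cs] := cps; have [-> ->] := IH _ cs.
rewrite !andbT; split; apply/negP => /mapP[[e Sg] eS] /= pE.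
  have [_ _ eSg _ _] := collapse_mem cs eS.
  by have [] := @collapse_used G p s _ _ cps eS; rewrite pE eSg.
by have [_] := @collapse_used G p s _ _ cps eS; rewrite pE eqxx.
Qed.

(** A gradient walk from a collapsed edge to its triangle continues to an edge of
    that triangle, which is collapsed later: had it been collapsed before,
    this triangle would have been gone. *)
Lemma collapse_index G s e Sg e' : collapse G s -> (e, Sg) \in s -> e' \in unzip1 s ->
  contained e' Sg -> e' != e -> index e (unzip1 s) < index e' (unzip1 s).
Proof.
elim: s G => //= p s IH G cps; have [fr cs] := cps; rewrite !inE => eS e's e'S e'e.
have [/andP[pns _] _] := @collapse_uniq G (p :: s) cps.
case/orP: eS => [/eqP pE|eS]; first by rewrite -pE /= eqxx eq_sym (negPf e'e).
have ep : (p.1 == e) = false.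
  by apply: contraNF pns => /eqP->; apply/mapP; exists (e, Sg).
rewrite ep; case/orP: e's => [/eqP e'p|e's].
  by have [] := @collapse_used G p s _ _ cps eS; rewrite -e'p e'S.
have -> : (p.1 == e') = false by apply: contraNF pns => /eqP->.
by rewrite ltnS (IH _ cs).
Qed.

(** A property which passes to an edge from the other edges of a triangle spreads
    from the uncollapsed edges to all edges, the last collapsed edge coming
    first. The hypothesis bears on the edges of the remaining triangles, since
    an edge collapsed earlier is uncollapsed by the rest of the sequence. *)
Lemma collapse_spread (Q : simplex T -> Prop) G s :
    (forall e Sg, (e, Sg) \in s -> e \in S 1 -> Sg \in S 2 -> contained e Sg -> ~~ repeated_face e Sg ->
       (forall e', e' \in S 1 -> contained e' Sg -> e' != e -> Q e') -> Q e) ->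
    collapse G s ->
    (forall e, e \in S 1 -> e \notin unzip1 s ->
      (exists2 f, contained e (triangle f) & f \notin G) -> Q e) ->
  forall e, e \in unzip1 s -> Q e.
Proof.
move=> hQ; elim: s G hQ => //= p s IH G hQ cps hE.
have [fr cs] := cps; have [p1 pS pr [f fS fG] _] := fr.
have Qs e : e \in unzip1 s -> Q e.
  move: e; apply: (IH _ _ cs) => [e Sg eS|e e1 es [g eg]]; first by apply: hQ; rewrite inE eS orbT.
  rewrite !inE negb_or => /andP[gG gp]; apply: hE => //; last by exists g.
  rewrite inE negb_or es andbT; apply: contra gp => /eqP ep.
  by rewrite ep in eg; apply/eqP/(free_used fr eg).
move=> e; rewrite inE => /orP[/eqP->|]; last exact: Qs.
apply: (hQ _ p.2) => //; [by rewrite inE -surjective_pairing eqxx | by rewrite -fS triangle_S2 |].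
move=> e' e'1 e'p e'e; have [/Qs//|e's] := boolP (e' \in unzip1 s).
by apply: hE => //; [rewrite inE negb_or e'e | exists f; rewrite ?fS].
Qed.

(** A loop joins its vertex to itself, which is why the ends are recorded as an
    ordered pair. *)
Definition joins (e v w : simplex T) := [exists x : flag T,
  [&& cls (flag_edge x) == e, cls (x.1, [set x.2 o0]) == v & cls (x.1, [set x.2 o1]) == w]].
Definition skeleton (F : {set simplex T}) : rel (simplex T) := fun v w =>
  [exists e in F, joins e v w].

Lemma joins_edge t a b : a != b -> joins (cls (t, [set a; b])) (cls (t, [set a])) (cls (t, [set b])).
Proof.
move=> ab; have [x [x1 xa xb]] := flag_of_edge t ab.
by apply/existsP; exists x; rewrite /flag_edge x1 xa xb !eqxx.
Qed.

Lemma joinsP e v w : joins e v w -> exists t a b,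
  [/\ a != b, e = cls (t, [set a; b]), v = cls (t, [set a]) & w = cls (t, [set b])].
Proof.
case/existsP=> x /and3P[/eqP<- /eqP<- /eqP<-]; exists x.1, (x.2 o0), (x.2 o1).
by rewrite (inj_eq perm_inj).
Qed.

Lemma joins_sym e v w : joins e v w = joins e w v.
Proof.
suff sub a b : joins e a b -> joins e b a by apply/idP/idP; exact: sub.
by case/joinsP=> t [i [j [ij -> -> ->]]]; rewrite setUC; apply: joins_edge; rewrite eq_sym.
Qed.

Lemma joins_contained e v w u : joins e v w -> u \in S 0 -> contained u e -> u = v \/ u = w.
Proof. by case/joinsP=> t [a [b [_ -> -> ->]]]; exact: vertex_edge. Qed.

Lemma joins_facts e v w : joins e v w -> [/\ e \in S 1, v \in S 0, w \in S 0, contained v e & contained w e].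
Proof.
case/joinsP=> t [a [b [ab -> -> ->]]]; split; rewrite ?edge_S1 ?vertex_S0 //;
  by apply: class_contained; rewrite sub1set !inE eqxx ?orbT.
Qed.

Lemma joins_norep e v w : joins e v w -> v != w -> ~~ repeated_face v e.
Proof.
case/joinsP=> t [a [b [ab -> -> ->]]]; apply: contra => /(repeated_class (vertex_S0 _ _)).
case=> A [B [/= AB sA sB EA EB]].
have one (C : {set 'I_4}) : C \subset [set a; b] -> cls (t, [set a]) = cls (t, C) -> C = [set a] \/ C = [set b].
  move=> sC EC; have [_] := simplex_class (c := (t, C)) (vertex_S0 t a) (ltac:(by rewrite EC mem_class)).
  move/eqP/cards1P => [c cC]; move: sC; rewrite /= in cC.
  by rewrite cC sub1set !inE => /orP[]/eqP->; [left | right].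
have [eA|eA] := one A sA EA; have [eB|eB] := one B sB EB; rewrite eA eB ?eqxx // in AB EA EB *; by apply/eqP.
Qed.

Lemma skeleton_csym F : connect_sym (skeleton F).
Proof.
apply: sym_connect_sym; suff sub v w : skeleton F v w -> skeleton F w v.
  by move=> v w; apply/idP/idP; exact: sub.
by case/existsP=> e /andP[eF vw]; apply/existsP; exists e; rewrite eF joins_sym.
Qed.

Lemma skeleton_connected (R : rel (simplex T)) : connect_sym R ->
  (forall e v w, joins e v w -> connect R v w) ->
  {in S 0 &, forall v w, connect R v w}.
Proof.
move=> Rs RJ; have Rt t a b : connect R (cls (t, [set a])) (cls (t, [set b])).
  by have [->|ab] := eqVneq a b; [exact: connect0 | exact: RJ (joins_edge t ab)].
move=> _ _ /vertexP[t [a ->]] /vertexP[u [b ->]].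
have tu := tconnected t u; move: b; move: u tu.
apply: connect_ind => [|u u' _ IH /existsP[i /andP[_ /eqP<-]]] b; first exact: Rt.
have [c ci] : exists c : 'I_4, c != i.
  by have [->|] := eqVneq i o0; [exists o1 | exists o0; rewrite eq_sym].
apply: connect_trans (IH c) _; apply: connect_trans (Rt (nbr u i) (gmap u i c) b).
by rewrite -imset_set1 cls_cross ?connect0 // inE eq_sym.
Qed.

(** In a triangle, the other two edges form a path between the ends of the third
    one; so collapsing an edge does not disconnect the 1-skeleton. *)
Lemma uncollapsed_connected G s : collapse G s ->
  {in S 0 &, forall v w, connect (skeleton (uncollapsed s)) v w}.
Proof.
move=> cs; apply: skeleton_connected; first exact: skeleton_csym.
set R := connect _; pose Q e := forall v w, joins e v w -> R v w.
have Rs : symmetric R := @skeleton_csym _.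
have Qu e : e \in S 1 -> e \notin unzip1 s -> Q e.
  move=> e1 es v w vw; apply: connect1; apply/existsP; exists e.
  by rewrite inE e1 es vw.
suff Qs e : e \in unzip1 s -> Q e.
  move=> e v w vw; have [e1 _ _ _ _] := joins_facts vw.
  by have [es|es] := boolP (e \in unzip1 s); [exact: Qs vw | exact: Qu vw].
move: e; apply: (collapse_spread _ cs) => [e Sg _ e1 S2 eS nr h|e e1 es _]; last exact: Qu.
have [f fS] := triangleP S2; rewrite {}fS in eS nr h.
have [a [b [ab af bf eE]]] := edge_triangle e1 eS.
have [c [ca cb cf]] := ord4_avoid3 a b f.2.
have Qc i : i \in [set a; b] -> R (cls (f.1, [set i])) (cls (f.1, [set c])).
  move=> iab; have ic : i != c by move: iab; rewrite !inE => /orP[]/eqP->; rewrite eq_sym.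
  have fi : i != f.2 by move: iab; rewrite !inE => /orP[]/eqP->.
  apply: (h (cls (f.1, [set i; c]))); [exact: edge_S1 | exact: triangle_edge | | exact: joins_edge].
  apply: contra nr => /eqP icE; rewrite eE; apply: (class_repeated (B := [set i; c])).
  - by apply: contraNneq (ca) => /setP/(_ c); rewrite !inE eqxx orbT (negPf ca) (negPf cb).
  - by rewrite subUset !sub1set !inE af.
  - by rewrite subUset !sub1set !inE fi cf.
  - by rewrite icE.
have Qab i j : i \in [set a; b] -> j \in [set a; b] -> R (cls (f.1, [set i])) (cls (f.1, [set j])).
  by move=> /Qc ic /Qc jc; apply: connect_trans ic _; rewrite -/(R _ _) Rs.
move=> v w /joins_facts[_ v0 w0 ve we]; rewrite eE in ve we.
by case: (vertex_edge v0 ve) (vertex_edge w0 we) => -> [] ->; apply: Qab; rewrite !inE eqxx ?orbT.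
Qed.

End Collapses.

(** * A criterion of acyclicity *)

Section Layers.
Variable T : triangulation.
Local Notation S := (simplices T).
Local Notation field := {set simplex T * simplex T}.
Implicit Types (x y z : simplex T).

(** A walk can only climb by a pair of L and has to descend next, so that a cycle
    stays within two consecutive dimensions. It is enough to rank, in each
    dimension, the lower simplices of the pairs. The ranks are then spread out
    into one function mu, which descends along all walks: pairs of dimensions
    (k, k + 1) get the values between base k and base k.+1, and the upper
    simplex of a pair comes right after the lower one. *)
Lemma acyclic_of_layers (L : field) (h : simplex T -> nat) : discrete_vector_field L ->
  (forall p, p \in L -> ~~ repeated_face p.1 p.2) ->
  (forall k x y x', (x, y) \in L -> x \in S k -> x' \in S k -> contained x' y -> x' != x ->
     (exists y', (x', y') \in L) -> h x' < h x) ->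
  acyclic L.
Proof.
move=> dL nr hL; apply/andP; split; last by apply/forallP => p; apply/implyP; exact: nr.
case/andP: (dL) => /forallP Lp /forallP Ld.
have Lu p q x : p \in L -> q \in L -> x \in [set p.1; p.2] -> x \in [set q.1; q.2] -> p = q.
  move=> pL qL xp xq; have /implyP/(_ pL)/forallP/(_ q)/implyP/(_ qL)/implyP hd := Ld p.
  by apply: contraTeq xq => /hd /disjointFr; move/(_ x xp)=> ->.
pose dim x : nat := odflt ord0 [pick k : 'I_4 | x \in S k].
have dimE x k : k < 4 -> x \in S k -> dim x = k.
  move=> k4 xk; rewrite /dim; case: pickP => [l xl|/(_ (Ordinal k4))]; last by rewrite /= xk.
  by rewrite /= (simplex_dim xk xl).
pose H := \max_x h x; have hH x : h x <= H by exact: leq_bigmax.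
(* The values of mu in layer k lie between base k and base k + 2 H + 3. *)
pose base k := k * (2 * H + 5).
have baseS k : base k.+1 = base k + (2 * H + 5) by rewrite /base mulSn addnC.
(* An upper simplex gets its value from the lower one; critical simplices stay at
   the bottom of their layer. *)
pose mu x := if [pick p in L | p.2 == x] is Some p then base (dim p.1) + 2 * h p.1 + 2
  else if [exists p in L, p.1 == x] then base (dim x) + 2 * h x + 3 else base (dim x).
have mu2 x y : (x, y) \in L -> mu y = base (dim x) + 2 * h x + 2.
  move=> xyL; rewrite /mu; case: pickP => [q /andP[qL /eqP qy]|/(_ (x, y))]; last by rewrite /= xyL eqxx.
  by rewrite (Lu q (x, y) y) // ?inE /= ?qy eqxx ?orbT.
have Lk x y : (x, y) \in L -> exists k, [/\ k < 3, x \in S k, y \in S k.+1 & contained x y].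
  by move=> xyL; have /implyP/(_ xyL)/existsP[k /and3P[? ? ?]] := Lp (x, y); exists k.
have mu1 x y : (x, y) \in L -> mu x = base (dim x) + 2 * h x + 3.
  move=> xyL; rewrite /mu; case: pickP => [q /andP[qL /eqP qx]|_].
    have qE : q = (x, y) by apply: (Lu q (x, y) x); rewrite // ?inE /= ?qx eqxx ?orbT.
    have [k [_ xk yk _]] := Lk x y xyL; rewrite qE /= in qx.
    by rewrite qx in yk; have := simplex_dim xk yk; lia.
  by case: existsP => // -[]; exists (x, y); rewrite xyL eqxx.
have mu_lt x : mu x < base (dim x).+1.
  rewrite /mu; case: pickP => [q /andP[qL /eqP qx]|_]; last by case: ifP => _; have := hH x; rewrite /base; lia.
  case: q qL qx => q1 q2 /= qL qx; have [k [k3 q1k q2k _]] := Lk _ _ qL.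
  rewrite qx in q2k; rewrite (dimE _ _ _ q1k) ?(dimE _ _ _ q2k) //; last exact: ltnW.
  by have := hH q1; rewrite /base; lia.
have dec x y : walk_step L x y -> mu y < mu x.
  case/orP=> [xyL|/existsP[k /and4P[xk yk yx nyx]]].
    by rewrite (mu2 _ _ xyL) (mu1 _ _ xyL); lia.
  have k3 := ltn_ord k; have dx := dimE x _ (k3 : k.+1 < 4) xk; have dy := dimE y _ (ltnW k3) yk.
  have [q /andP[qL /eqP qx]|nx] := pickP [pred q in L | q.2 == x]; last first.
    have : base k.+1 <= mu x.
      rewrite /mu; case: pickP => [q|_]; first by have /= -> := nx q.
      by rewrite dx; move: (base k.+1) (h x); clear => b n; case: ifP => _; lia.
    by apply: leq_trans; rewrite -dy.
  case: q qL qx => z x' /= zL x'x; rewrite {x'}x'x in zL.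
  have [l [l3 zl xl _]] := Lk _ _ zL; have [kl] := simplex_dim xk xl; rewrite -kl in zl.
  rewrite (mu2 _ _ zL) (dimE z k (ltnW k3) zl).
  have yz : y != z by apply: contraNneq nyx => ->.
  have [w|ny] := pickP [pred w | (y, w) \in L].
    move=> /= yw; have := hL k z x y zL zl yk yx yz; rewrite (mu1 _ _ yw) dy => /(_ (ex_intro _ w yw)).
    by move: (h y) (h z) (base k); clear; lia.
  rewrite /mu; case: pickP => [[u y'] /= /andP[uL /eqP uy]|_].
    rewrite uy in uL; have [m [m3 um ym _]] := Lk _ _ uL; have km := simplex_dim yk ym.
    rewrite (dimE u m _ um); last exact: ltnW.
    rewrite km baseS; move: (hH u); move: (H) (h u) (h z) (base m); clear; lia.
  case: existsP => [[[y' w] /= /andP[ywL /eqP yE]]|_]; first by have := ny w; rewrite /= -yE ywL.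
  by rewrite dy; move: (h z) (base k); clear; lia.
by apply/forallP => x; apply/forallP => y; apply/implyP; exact: (acyclic_rank dec).
Qed.

End Layers.

(** * From collapses to gradients *)

Section GradientOfCollapse.
Variable T : triangulation.
Local Notation S := (simplices T).
Local Notation cls := (class (K := T) setT).
Local Notation N := #|tet T|.
Local Notation field := {set simplex T * simplex T}.

Lemma uniq_map_in (A B : eqType) (g : A -> B) (l : seq A) : uniq (map g l) -> {in l &, injective g}.
Proof.
elim: l => //= a l IH /andP[al /IH{}IH] x y; rewrite !inE.
case/predU1P=> [->|xl] /predU1P[->|yl] // gxy; last exact: IH.
  by rewrite gxy map_f in al.
by rewrite -gxy map_f in al.
Qed.
(** Every triangle of D links a tetrahedron to its parent: the links to the
    parents already connect everything, so any other triangle would lie on a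
    cycle of the tree. *)
Lemma dual_tree_parents (D : {set simplex T}) (t0 : tet T) : dual_spanning_tree D ->
  exists (d : tet T -> nat) (p : tet T -> 'I_4),
    (forall t, t != t0 -> triangle (t, p t) \in D /\ d (nbr t (p t)) < d t) /\
    (forall f, triangle f \in D -> exists2 t, t != t0 & triangle f = triangle (t, p t)).
Proof.
case/and3P=> _ /forallP con /forallP bri.
have [d dP] := distance_to (dual_adj D) t0.
have [|p pP] := @fin_all_exists (tet T) (fun=> 'I_4)
  (fun t i => t != t0 -> triangle (t, i) \in D /\ d (nbr t i) < d t).
  move=> t; have [->|tt0] := eqVneq t t0; first by exists ord0.
  have /forallP/(_ t0) := con t; move/(dP t tt0) => [u /andP[/existsP[i /andP[iD /eqP<-]] lt_d]].
  by exists i.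
exists d, p; split=> // f fD.
have := bri f; rewrite fD /= => nf.
have [/existsP[t /andP[tt0 /eqP ft]]|nex] := boolP [exists t, (t != t0) && (triangle f == triangle (t, p t))].
  by exists t.
(* The parents alone connect every tetrahedron to t0 without f. *)
have tot0 t : connect (dual_adj (D :\ triangle f)) t t0.
  have [n] := ubnP (d t); elim: n t => // n IH t lt_n.
  have [->|tt0] := eqVneq t t0; first exact: connect0.
  have [tD lt_d] := pP t tt0; apply: connect_trans (connect1 _) (IH (nbr t (p t)) _); last by lia.
  apply/existsP; exists (p t); rewrite eqxx andbT !inE tD andbT.
  by apply: contra nex => /eqP E; apply/existsP; exists t; rewrite tt0 E eqxx.
case/negP: nf; apply: connect_trans (tot0 _) _.
by rewrite (sym_connect_sym (@dual_adj_sym _ _)).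
Qed.

Lemma skeleton_parents (E : {set simplex T}) (r : simplex T) :
  {in S 0, forall v, connect (skeleton E) v r} ->
  exists (d : simplex T -> nat) (p : simplex T -> simplex T),
    forall v, v \in S 0 -> v != r -> p v \in E /\ exists2 w, joins (p v) v w & d w < d v.
Proof.
move=> con; have [d dP] := distance_to (skeleton E) r.
have [|p pP] := @fin_all_exists (simplex T) (fun=> simplex T)
  (fun v e => v \in S 0 -> v != r -> e \in E /\ exists2 w, joins e v w & d w < d v).
  move=> v; have [v0|] := boolP (v \in S 0); last by exists r.
  have [->|vr] := eqVneq v r; first by exists r.
  have [w /andP[/existsP[e /andP[eE vw]] lt_d]] := dP v vr (con v v0).
  by exists e => _ _; split=> //; exists w.
by exists d, p.
Qed.

Variables (D : {set simplex T}) (s : seq (simplex T * simplex T)).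
Hypotheses (hD : dual_spanning_tree D) (cs : collapse (sides D) s).

(** The uncollapsed edges are connected, hence they form a tree as soon as they
    are few enough. As D has at most N - 1 triangles, at least N + 1 of the 2
    N triangles, and as many edges, are collapsed; at most #|S 0| + N edges
    existed. *)
Lemma card_uncollapsed : #|uncollapsed s| < #|S 0|.
Proof.
have [us us2] := collapse_uniq cs.
have /card_gt0P[t0 _] := tet_gt0 T; have [d [p [pP pD]]] := dual_tree_parents t0 hD.
have cD : #|D| <= N.-1.
  rewrite -(cardsC1 t0); apply: leq_trans (leq_imset_card (fun t => triangle (t, p t)) [set~ t0]).
  apply/subset_leq_card/subsetP => x xD; have x2 : x \in S 2.
    by case/and3P: hD => /subsetP sub _ _; exact: sub.
  have [f fx] := triangleP x2; rewrite fx in xD *; have [t tt0 ->] := pD f xD.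
  by apply: imset_f; rewrite !inE.
have cS2 : #|S 2| <= #|D| + size s.
  have -> : size s = #|[set x in unzip2 s]|.
    by rewrite cardsE (card_uniqP us2) size_map.
  apply: leq_trans (leq_card_setU _ _); apply/subset_leq_card/subsetP => x.
  case/triangleP=> f ->; rewrite !inE; have [//|fD] := boolP (triangle f \in D).
  by rewrite (collapse_cover cs) // inE.
have cS1 : #|uncollapsed s| + size s = #|S 1|.
  have -> : size s = #|[set x in unzip1 s]| by rewrite cardsE (card_uniqP us) size_map.
  have -> : uncollapsed s = S 1 :\: [set x in unzip1 s] by apply/setP => e; rewrite !inE andbC.
  have sub1 : [set x in unzip1 s] \subset S 1.
    by apply/subsetP => e; rewrite inE => /mapP[[e' x] ex /= ->]; case: (collapse_mem cs ex).
  by rewrite cardsDS // subnK // subset_leq_card.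
have := card_triangles T; have := euler_ineq T; have := tet_gt0 T; lia.
Qed.

Section Assembly.
Local Notation E := (uncollapsed s).
Variables (t0 : tet T) (dt : tet T -> nat) (pt : tet T -> 'I_4).
Hypothesis ptD : forall t, t != t0 ->
  triangle (t, pt t) \in D /\ dt (nbr t (pt t)) < dt t.
Hypothesis pt_onto : forall f, triangle f \in D ->
  exists2 t, t != t0 & triangle f = triangle (t, pt t).
Variables (r : simplex T) (d : simplex T -> nat) (pe : simplex T -> simplex T).
Hypothesis r0 : r \in S 0.
Hypothesis peP : forall v, v \in S 0 -> v != r ->
  pe v \in E /\ exists2 w, joins (pe v) v w & d w < d v.

Lemma pe_inj : {in S 0 :\ r &, injective pe}.
Proof.
move=> v v'; rewrite !in_setD1 => /andP[vr v0] /andP[v'r v'0] vv'.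
have [_ [w vw lt_w]] := peP v0 vr; have [_ [w' v'w' lt_w']] := peP v'0 v'r.
rewrite -vv' in v'w'; have [_ _ _ cv cw] := joins_facts vw; have [_ _ _ cv' _] := joins_facts v'w'.
have [//|v'w] := joins_contained vw v'0 cv'.
have [//|vw'] := joins_contained v'w' v0 cv.
by rewrite v'w -vw' in lt_w'; have := ltn_trans lt_w lt_w'; rewrite ltnn.
Qed.

(** There are at least as many parent edges as uncollapsed edges, so that all of
    the latter belong to the tree. *)
Lemma pe_onto : pe @: (S 0 :\ r) = E.
Proof.
apply/eqP; rewrite eqEcard (card_in_imset pe_inj); apply/andP; split.
  by apply/subsetP => _ /imsetP[v vS ->]; move: vS; rewrite in_setD1 => /andP[vr v0]; have [] := peP v0 vr.
by have := card_uncollapsed; rewrite (cardsD1 r (S 0)) r0; lia.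
Qed.

Lemma pt_inj : {in [set~ t0] &, injective (fun t => triangle (t, pt t))}.
Proof.
move=> t u; rewrite !inE => tt0 ut0 /triangle_eq[[]//|E1].
have [_ lt1] := ptD tt0; have [_ lt2] := ptD ut0.
have E2 := congr1 (@opp T) E1; rewrite oppK in E2.
have e1 : t = nbr u (pt u) := congr1 fst E1; have e2 : nbr t (pt t) = u := congr1 fst E2.
by rewrite e2 in lt1; rewrite -e1 in lt2; have := ltn_trans lt1 lt2; rewrite ltnn.
Qed.

Definition vertex_pairs := [set (v, pe v) | v in S 0 :\ r].
Definition collapse_pairs := [set p in s].
Definition tetra_pairs := [set (triangle (t, pt t), tetra t) | t in [set~ t0]].
(** Each vertex points to the edge towards its parent, and each triangle of D to
    the child it links: the gradient flows towards the root r on the edges,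
    and away from the root t0 on the tetrahedra. *)
Definition assembled : field := vertex_pairs :|: collapse_pairs :|: tetra_pairs.

Lemma vertex_pairP x y : reflect [/\ x \in S 0, x != r & y = pe x] ((x, y) \in vertex_pairs).
Proof.
apply: (iffP imsetP) => [[v]|[x0 xr ->]]; first by rewrite !inE => /andP[vr v0] [-> ->].
by exists x; rewrite // !inE xr.
Qed.

Lemma collapse_pairE x y : ((x, y) \in collapse_pairs) = ((x, y) \in s).
Proof.
by rewrite inE.
Qed.

Lemma tetra_pairP x y : reflect (exists t, [/\ t != t0, x = triangle (t, pt t) & y = tetra t]) ((x, y) \in tetra_pairs).
Proof.
by apply: (iffP imsetP) => [[t]|[t [tt0 -> ->]]]; [rewrite !inE => tt0 [-> ->]; exists t | exists t; rewrite // !inE].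
Qed.

Lemma assembled_cases x y : (x, y) \in assembled -> [\/ (x, y) \in vertex_pairs, (x, y) \in collapse_pairs | (x, y) \in tetra_pairs].
Proof.
by rewrite !inE -orbA => /or3P.
Qed.

Lemma vertex_pair x y : (x, y) \in vertex_pairs -> [/\ x \in S 0, y \in S 1, contained x y, ~~ repeated_face x y & y \in E].
Proof.
case/vertex_pairP=> x0 xr ->; have [peE [w vw lt_w]] := peP x0 xr; have [e1 _ _ cv _] := joins_facts vw.
by split=> //; apply: joins_norep vw _; apply: contraTneq lt_w => ->; rewrite ltnn.
Qed.

Lemma collapse_pair x y : (x, y) \in collapse_pairs -> [/\ x \in S 1, y \in S 2, contained x y, ~~ repeated_face x y & x \in unzip1 s /\ y \notin D].
Proof.
rewrite collapse_pairE => xy; have [? ? ? ? [f fS fD]] := collapse_mem cs xy; split=> //.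
split; first by apply/mapP; exists (x, y).
by move: fD; rewrite inE fS.
Qed.

Lemma tetra_pair x y : (x, y) \in tetra_pairs -> [/\ x \in S 2, y \in S 3, contained x y, ~~ repeated_face x y & x \in D].
Proof.
case/tetra_pairP=> t [tt0 -> ->]; have [tD lt_t] := ptD tt0.
split; rewrite ?triangle_S2 ?tetra_S3 ?tetra_triangle //.
by apply: contraTN lt_t => /repeated_tetra->; rewrite ltnn.
Qed.

Lemma assembled_pair x y : (x, y) \in assembled -> exists k, [/\ k < 3, x \in S k, y \in S k.+1, contained x y & ~~ repeated_face x y].
Proof.
by case/assembled_cases => [/vertex_pair|/collapse_pair|/tetra_pair] [? ? ? ? _]; [exists 0 | exists 1 | exists 2].
Qed.

Lemma assembled_layer x y k : (x, y) \in assembled -> x \in S k ->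
    [\/ (x, y) \in vertex_pairs /\ k = 0, (x, y) \in collapse_pairs /\ k = 1 | (x, y) \in tetra_pairs /\ k = 2].
Proof.
case/assembled_cases => h xk; [constructor 1 | constructor 2 | constructor 3]; split=> //.
- by have [x0 _ _ _ _] := vertex_pair h; exact: simplex_dim xk x0.
- by have [x0 _ _ _ _] := collapse_pair h; exact: simplex_dim xk x0.
- by have [x0 _ _ _ _] := tetra_pair h; exact: simplex_dim xk x0.
Qed.

Lemma assembled_fun x y z : (x, y) \in assembled -> (x, z) \in assembled -> y = z.
Proof.
move=> xy xz; have [k [_ xk _ _ _]] := assembled_pair xy.
case: (assembled_layer xy xk) => -[h kE]; rewrite {k}kE in xk; case: (assembled_layer xz xk) => -[h' //] _.
- by case/vertex_pairP: h => _ _ ->; case/vertex_pairP: h' => _ _ ->.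
- by rewrite !collapse_pairE in h h'; have [] := uniq_map_in (proj1 (collapse_uniq cs)) h h' (erefl x).
- case/tetra_pairP: h => t [tt0 xt ->]; case/tetra_pairP: h' => u [ut0 xu ->].
  by congr tetra; apply: pt_inj; rewrite ?inE //= -xt.
Qed.

Lemma assembled_inj x y z : (x, z) \in assembled -> (y, z) \in assembled -> x = y.
Proof.
move=> xz yz; have [k [_ xk zk _ _]] := assembled_pair xz; have [l [_ yl zl _ _]] := assembled_pair yz.
have [kl] := simplex_dim zk zl; rewrite -{l zl}kl in yl.
case: (assembled_layer xz xk) => -[h kE]; rewrite {k zk xk}kE in yl; case: (assembled_layer yz yl) => -[h' //] _.
- case/vertex_pairP: h => x0 xr zx; case/vertex_pairP: h' => y0 yr zy.
  by apply: pe_inj; rewrite ?in_setD1 ?xr ?yr // -zx.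
- by rewrite !collapse_pairE in h h'; have [] := uniq_map_in (proj2 (collapse_uniq cs)) h h' (erefl z).
- by case/tetra_pairP: h => t [tt0 -> zt]; case/tetra_pairP: h' => u [ut0 -> zu]; rewrite (tetra_inj (etrans (esym zt) zu)).
Qed.

Lemma assembled_no_chain x y z : (x, y) \in assembled -> (y, z) \in assembled -> False.
Proof.
move=> xy yz; have [k [_ xk yk _ _]] := assembled_pair xy.
case: (assembled_layer xy xk) => -[h kE]; rewrite {k xk}kE in yk; case: (assembled_layer yz yk) => -[h' //] _.
- have [_ _ _ _] := vertex_pair h; have [_ _ _ _ [ys _]] := collapse_pair h'.
  by rewrite inE ys andbF.
- have [_ _ _ _ [_ yD]] := collapse_pair h; have [_ _ _ _ yD'] := tetra_pair h'.
  by rewrite yD' in yD.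
Qed.

Lemma assembled_field : discrete_vector_field assembled.
Proof.
apply/andP; split; apply/forallP => -[x y]; apply/implyP => xy.
  have [k [k3 xk yk cxy _]] := assembled_pair xy.
  by apply/existsP; exists (Ordinal k3); rewrite xk yk.
apply/forallP => -[z w]; apply/implyP => zw; apply/implyP; apply: contraR.
rewrite -setI_eq0 => /set0Pn[a]; rewrite !inE /= => /andP[/orP[]/eqP-> /orP[]/eqP E1].
- by rewrite E1 in xy *; rewrite (assembled_fun xy zw).
- by rewrite E1 in xy; case: (assembled_no_chain zw xy).
- by rewrite E1 in xy; case: (assembled_no_chain xy zw).
- by rewrite E1 in xy *; rewrite (assembled_inj xy zw).
Qed.

(** In the three layers the walks approach the root r, follow the order of the
    collapse, and move away from the root t0. *)
Lemma assembled_acyclic : acyclic assembled.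
Proof.
have [own ownP] : exists own : simplex T -> tet T, forall t, t != t0 -> own (triangle (t, pt t)) = t.
  exists (fun x => odflt t0 [pick t | (t != t0) && (triangle (t, pt t) == x)]) => t tt0.
  case: pickP => [u /andP[ut0 /eqP tu]|/(_ t)]; last by rewrite tt0 eqxx.
  by apply: pt_inj; rewrite ?inE.
pose M := \max_t dt t; have dM t : dt t <= M by exact: leq_bigmax.
(* Ranks have to decrease along the walks, hence the subtractions. *)
pose h x := if x \in S 0 then d x else if x \in S 1 then size s - index x (unzip1 s)
  else M - dt (own x).
apply: (acyclic_of_layers (h := h)) assembled_field _ _ => [[x y] /assembled_pair[k []]//|k x y x' xy xk x'k cx'y x'x [y' x'y']].
rewrite /h !(simplex_dimE _ xk) !(simplex_dimE _ x'k).
case: (assembled_layer xy xk) => -[h1 kE]; rewrite {k}kE /= in xk x'k *;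
  case: (assembled_layer x'y' x'k) => -[h2 //] _.
- case/vertex_pairP: h1 => x0 xr yE; have [_ [w xw lt_w]] := peP x0 xr; rewrite -yE in xw.
  by have [x'E|->//] := joins_contained xw x'k cx'y; rewrite x'E eqxx in x'x.
- rewrite !collapse_pairE in h1 h2; have x's : x' \in unzip1 s by apply/mapP; exists (x', y').
  have lt_i := collapse_index cs h1 x's cx'y x'x.
  apply: ltn_sub2l (lt_i); rewrite -(size_map fst) index_mem.
  by apply/mapP; exists (x, y).
- case/tetra_pairP: h1 => t [tt0 xE yE]; case/tetra_pairP: h2 => u [ut0 x'E y'E].
  rewrite xE x'E !ownP //; rewrite yE in cx'y; have [i x'i] := triangle_tetra x'k cx'y.
  rewrite x'E in x'i x'x; have [_ lt_u] := ptD ut0.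
  have [[ut _]|ut] := triangle_eq x'i; first by rewrite ut xE eqxx in x'x.
  have := congr1 (@opp T) ut; rewrite oppK => /(congr1 fst) /= ntu.
  by rewrite ntu in lt_u; exact: ltn_sub2l (leq_trans lt_u (dM u)) lt_u.
Qed.

Lemma critical_assembled : critical assembled = [set r; tetra t0].
Proof.
have all k x : k < 4 -> x \in S k -> x \in all_simplices T.
  by move=> k4 xk; apply/bigcupP; exists (Ordinal k4).
apply/setP => x; rewrite [RHS]in_set2 [LHS]inE; apply/andP/orP => [[/bigcupP[[k k4] _ /= xk] cx]|xrt].
  have cr p : p \in assembled -> x != p.1 /\ x != p.2.
    by move=> pL; have /forallP/(_ p)/implyP/(_ pL)/andP := cx.
  have nL1 y : (x, y) \notin assembled by apply/negP => /cr[]; rewrite eqxx.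
  have nL2 y : (y, x) \notin assembled by apply/negP => /cr[_]; rewrite eqxx.
  case: k k4 xk => [|[|[|[|//]]]] _ xk.
  - left; apply: contraT => xr; case/negP: (nL1 (pe x)).
    by rewrite !in_setU; apply/orP; left; apply/orP; left; apply/vertex_pairP.
  - have [xs|xs] := boolP (x \in unzip1 s).
      case/mapP: xs => [[x' y] xy /= xx']; case/negP: (nL1 y).
      by rewrite !in_setU collapse_pairE xx' xy orbT.
    have : x \in E by rewrite inE xk xs.
    rewrite -pe_onto => /imsetP[v vS xE]; case/negP: (nL2 v).
    rewrite xE !in_setU; apply/orP; left; apply/orP; left; apply/vertex_pairP.
    by move: vS; rewrite in_setD1 => /andP[].
  - have [xD|xD] := boolP (x \in D).
      have [f fx] := triangleP xk; rewrite fx in xD nL1; have [t tt0 ft] := pt_onto xD.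
      by case/negP: (nL1 (tetra t)); rewrite !in_setU; apply/orP; right; apply/tetra_pairP; exists t.
    have [f fx] := triangleP xk; have : triangle f \in unzip2 s.
      by apply: (collapse_cover cs); rewrite inE -fx.
    rewrite -fx => /mapP[[y x'] yx /= xx']; case/negP: (nL2 y).
    by rewrite !in_setU collapse_pairE xx' yx orbT.
  - right; have [t xt] := tetraP xk; rewrite xt in nL2 *; apply: contraT => tt0.
    case/negP: (nL2 (triangle (t, pt t))); rewrite !in_setU; apply/orP; right; apply/tetra_pairP.
    by exists t; split=> //; apply: contra tt0 => /eqP->.
split; first by case: xrt => /eqP->; [exact: all r0 | apply: all (tetra_S3 t0)].
apply/forallP => -[y z]; apply/implyP => yz /=; have [k [k3 yk zk _ _]] := assembled_pair yz.
case: xrt => /eqP->; apply/andP; split; apply/eqP => E1.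
- rewrite -E1 in yz; have [[/vertex_pairP[_]]|[_ //]|[_ //]] := assembled_layer yz r0.
  by rewrite eqxx.
- by rewrite -E1 in zk; have := simplex_dim r0 zk.
- rewrite -E1 in yk; have kE := simplex_dim (tetra_S3 t0) yk; by rewrite -kE in k3.
- rewrite -E1 in yz zk; have [kE] := simplex_dim (tetra_S3 t0) zk; rewrite -kE in yk.
  have [[_ //]|[_ //]|[/tetra_pairP[t [tt0 _ /tetra_inj t0t]] _]] := assembled_layer yz yk.
  by rewrite t0t eqxx in tt0.
Qed.

Lemma vertex_tree_assembled : vertex_tree assembled = E.
Proof.
apply/setP => e; rewrite -pe_onto; apply/imsetP/imsetP => [[[v e'] /=]|[v vS ->]].
  rewrite inE => /andP[veL v0] ->; case: (assembled_layer veL v0) => -[] // /vertex_pairP[_ vr ->] _.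
  by exists v; rewrite // !inE vr.
exists (v, pe v) => //; rewrite inE /=; move: vS; rewrite !in_setD1 => /andP[vr v0].
by rewrite v0 andbT !inE; apply/orP; left; apply/orP; left; apply/vertex_pairP.
Qed.

Lemma tet_tree_assembled : tet_tree assembled = D.
Proof.
apply/setP => x; apply/imsetP/idP => [[[x' y] /=]|xD].
  rewrite inE => /andP[xyL y3] ->; have [k [_ xk yk _ _]] := assembled_pair xyL.
  have [kE] := simplex_dim yk y3; rewrite kE in xk.
  by case: (assembled_layer xyL xk) => -[] // /tetra_pair[].
have x2 : x \in S 2 by case/and3P: hD => /subsetP sub _ _; exact: sub.
have [f fx] := triangleP x2; rewrite fx in xD *; have [t tt0 ->] := pt_onto xD.
exists (triangle (t, pt t), tetra t) => //; rewrite inE /= tetra_S3 andbT !inE.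
by apply/orP; right; apply/tetra_pairP; exists t.
Qed.
End Assembly.

Lemma collapse_gradient : exists2 L : field, morse_gradient L && (#|critical L| == 2) &
  vertex_tree L = uncollapsed s /\ tet_tree L = D.
Proof.
have /card_gt0P[t0 _] := tet_gt0 T; have [dt [pt [ptD pt_onto]]] := dual_tree_parents t0 hD.
have r0 := vertex_S0 t0 o0.
have [|d [pe peP]] := @skeleton_parents (uncollapsed s) (cls (t0, [set o0])).
  by move=> v v0; have := uncollapsed_connected cs v0 r0.
exists (assembled t0 pt (cls (t0, [set o0])) pe).
  rewrite /morse_gradient (assembled_field ptD peP) (assembled_acyclic ptD peP) /=.
  rewrite (critical_assembled ptD pt_onto r0 peP) cards2.
  have [rt|//] := eqVneq (cls (t0, [set o0])) (tetra t0); rewrite rt in r0.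
  by have := simplex_dim r0 (tetra_S3 t0).
split; [exact: (vertex_tree_assembled ptD r0 peP) | exact: (tet_tree_assembled ptD pt_onto peP)].
Qed.

End GradientOfCollapse.

(** * The correspondence *)

(** Two equivalence relations which are the kernels of maps to a common type have
    the same quotients when these maps have the same values. *)
Lemma quotient_bijection (A B : choiceType) (rA : equiv_rel A) (rB : equiv_rel B) (K : eqType)
    (kA : A -> K) (kB : B -> K) :
    (forall a a', rA a a' = (kA a == kA a')) -> (forall b b', rB b b' = (kB b == kB b')) ->
    (forall a, exists b, kB b == kA a) -> (forall b, exists a, kA a == kB b) ->
  exists f : {eq_quot rA}%qT -> {eq_quot rB}%qT, bijective f.
Proof.
move=> rAE rBE exB exA; pose toB a := xchoose (exB a); pose toA b := xchoose (exA b).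
have toBk a : kB (toB a) = kA a := eqP (xchooseP (exB a)).
have toAk b : kA (toA b) = kB b := eqP (xchooseP (exA b)).
have reprA (a : A) : kA (generic_quotient.repr (\pi_({eq_quot rA}) a)%qT) = kA a.
  by apply/eqP; rewrite -rAE; apply/eqmodP; rewrite reprK.
have reprB (b : B) : kB (generic_quotient.repr (\pi_({eq_quot rB}) b)%qT) = kB b.
  by apply/eqP; rewrite -rBE; apply/eqmodP; rewrite reprK.
exists (fun x => \pi_({eq_quot rB})%qT (toB (generic_quotient.repr x))).
exists (fun y => \pi_({eq_quot rA})%qT (toA (generic_quotient.repr y))) => x.
  rewrite -[RHS]reprK; apply/eqmodP.
  by rewrite rAE toAk reprB toBk.
rewrite -[RHS]reprK; apply/eqmodP.
by rewrite rBE toBk reprA toAk.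
Qed.

Theorem proposition34 (T : triangulation) :
  exists f : {eq_quot repointing_equiv T}%qT ->
             {eq_quot weakly_equivalent_equiv T}%qT,
    bijective f.
Proof.
apply: (quotient_bijection (kA := fun L : morse2 T => (tet_tree (val L), vertex_tree (val L)))
  (kB := fun c : local_construction T => ((val c).1, critical_tree c))).
- move=> L L'; have /andP[gL cL] := valP L; have /andP[gL' cL'] := valP L'.
  rewrite /= /repointing xpair_eqE; case: eqP => /= [vE|_]; last by rewrite andbF.
  by case: eqP => //= tE; apply/eqP; exact: matching_unique.
- by move=> c c'; rewrite /= xpair_eqE.
- move=> L; have /andP[gL cL] := valP L; have [s cs sE] := gradient_collapse gL cL.
  have [s' fs sE'] := collapse_folds (@sides_closed T _) cs.
  have lc : dual_spanning_tree (tet_tree (val L)) && folds (sides (tet_tree (val L))) s'.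
    by rewrite tet_tree_spanning.
  exists (Sub (tet_tree (val L), s') lc).
  by rewrite /= xpair_eqE eqxx -sE -sE' /critical_tree /=; apply/eqP.
- move=> c; have /andP[hD fs] := valP c; have [s cs sE] := folds_collapse (@sides_closed T _) fs.
  have [L mL [vE tE]] := collapse_gradient hD cs.
  by exists (Sub L mL); rewrite /= xpair_eqE tE vE -sE eqxx; apply/eqP.
Qed.
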